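(* Let $\pi_N$ denote the invariant probability distribution on $\mathcal{P}(\mathcal{X})$ of the Markov process $(Y^N(t))$. Then any limiting point (for weak convergence, as $N\to\infty$) of the sequence $(\pi_N)$ is a probability distribution on $\mathcal{P}(\mathcal{X})$ carried by the set $\{y\in\mathcal{P}(\mathcal{X}):V(y)=0\}$ of equilibrium points of the dynamical system $y'(t)=V(y(t))$. In particular, if this dynamical system has a unique equilibrium point $y_\infty$, then the sequence of invariant distributions $(\pi_N)$ converges to the Dirac mass at $y_\infty$.
   Context: Fix integers $K\ge1$, $C\ge1$, positive integers $A_1,\dots,A_K$ and rates $\lambda_k>0$, $\gamma_k>0$, $\mu_k\ge0$ for $1\le k\le K$. Let $f_k$ be the $k$th unit vector of $\mathbb{R}^K$, let $$\mathcal{X}=\{n=(n_k)\in\mathbb{N}^K: A_1n_1+\cdots+A_Kn_K\le C\}\quad(\mathbb{N}=\{0,1,2,\dots\}),$$ and let $\mathcal{P}(\mathcal{X})$ be the set of probability distributions $y=(y_n)_{n\in\mathcal{X}}$ on the finite set $\mathcal{X}$. Write $\langle\mathbb{I}_k,y\rangle=\sum_{m\in\mathcal{X}}m_ky_m$. The vector field $V(y)=(V_n(y),\,n\in\mathcal{X})$ is $$V_n(y)=\sum_{k=1}^{K}(\lambda_k+\gamma_k\langle\mathbb{I}_k,y\rangle)\left(y_{n-f_k}\mathbf{1}_{\{n_k\ge1\}}-y_n\mathbf{1}_{\{n+f_k\in\mathcal{X}\}}\right)+\sum_{k=1}^{K}(\gamma_k+\mu_k)\left((n_k+1)y_{n+f_k}\mathbf{1}_{\{n+f_k\in\mathcal{X}\}}-n_ky_n\right),$$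 where terms multiplied by a zero indicator are $0$. The network has $N\ge2$ identical nodes of capacity $C$. External class $k$ customers arrive at each node at rate $\lambda_k$; each class $k$ customer leaves the network at rate $\mu_k$, and moves at rate $\gamma_k$ to a node chosen uniformly among the $N-1$ other nodes; a class $k$ customer occupies $A_k$ units of capacity at the node where it is, and a customer arriving at a node without enough free capacity is rejected (lost). The empirical distribution of the node states is $Y^N(t)=(Y^N_n(t))_{n\in\mathcal{X}}$, where $Y_n^N(t)$ is the proportion of nodes containing exactly $n_k$ class $k$ customers for every $k$. Equivalently, with $e_n$ the $n$th unit vector of $\mathbb{R}^{\mathcal{X}}$, $(Y^N(t))$ is the Markov jump process on $\{y\in\mathcal{P}(\mathcal{X}):Ny_n\in\mathbb{N}\ \forall n\}$ whose transitions from $y$ are, for $n,m\in\mathcal{X}$ and $1\le k\le K$: (i) $y\to y+\frac1N(e_{n+f_k}-e_n)$ at rate $\lambda_kNy_n\mathbf{1}_{\{n+f_k\in\mathcal{X}\}}$; (ii) $y\to y+\frac1N(e_{n-f_k}-e_n)$ at rate $\mu_kn_kNy_n$; (iii) $y\to y+\frac1N(e_{n-f_k}-e_n)+\frac1N(e_{m+f_k}-e_m)\mathbf{1}_{\{m+f_k\in\mathcal{X}\}}$ at rate $\frac{\gamma_kN}{N-1}n_ky_n(Ny_m-\mathbf{1}_{\{m=n\}})$ (rates of transitions leading to the same state are added). *)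

(* Defs.v *)
From HB Require Import structures.
From mathcomp Require Import all_boot all_order all_algebra.
From mathcomp Require Import all_classical all_reals all_analysis.

Set Implicit Arguments.
Unset Strict Implicit.
Unset Printing Implicit Defensive.

Import Order.TTheory GRing.Theory Num.Theory.
Import numFieldNormedType.Exports.

Local Open Scope classical_set_scope.
Local Open Scope ring_scope.

(* For A k > 0 every capacity-feasible n satisfies n k <= C, so that bounding
   the coordinates by C loses nothing and makes the type finite. *)
Definition state (K C : nat) (A : 'I_K -> nat) : finType :=
  {n : {ffun 'I_K -> 'I_C.+1} | (\sum_k A k * n k <= C)%N}.

Section NodeState.
Context {K C : nat} {A : 'I_K -> nat}.
Implicit Types n m : state C A.

Definition occ n (k : 'I_K) : nat := val n k.

(* n + f_k, or None when n + f_k is not a state *)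
Definition plus_f n (k : 'I_K) : option (state C A) :=
  [pick m : state C A | [forall i, occ m i == (occ n i + (i == k))%N]].

(* n - f_k, or None when n_k = 0 *)
Definition minus_f n (k : 'I_K) : option (state C A) :=
  [pick m : state C A | [forall i, occ n i == (occ m i + (i == k))%N]].

Lemma zero_state_subproof :
  (\sum_k A k * [ffun=> ord0 : 'I_C.+1] k <= C)%N.
Proof. by rewrite big1 // => k _; rewrite ffunE muln0. Qed.

Definition zero_state : state C A :=
  exist (fun n : {ffun 'I_K -> 'I_C.+1} => (\sum_k A k * n k <= C)%N)
    _ zero_state_subproof.

End NodeState.

Section ProbabilityVectors.
Context (R : realType) {K : nat} (C : nat) (A : 'I_K -> nat).

Definition simplex : set {ptws (state C A) -> R} :=
  [set y | (forall n, 0 <= y n) /\ \sum_n y n = 1].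

(* P(X) with the topology induced by the product topology of R^X *)
Definition pvec : Type := set_type simplex.

HB.instance Definition _ := Uniform.copy pvec (set_type simplex).

Lemma zero_pvec_subproof :
  (fun n : state C A => (n == zero_state)%:R : R) \in simplex.
Proof.
rewrite inE; split => [n|]; first exact: ler0n.
rewrite (bigD1 zero_state) //= eqxx big1 ?addr0 // => n.
by move=> /negPf ->.
Qed.

Definition zero_pvec : pvec :=
  exist (fun y => y \in simplex) _ zero_pvec_subproof.

HB.instance Definition _ := isPointed.Build pvec zero_pvec.

End ProbabilityVectors.

Definition pcoord (R : realType) (K C : nat) (A : 'I_K -> nat)
  (y : pvec R C A) : state C A -> R := set_val y.

Section VectorField.
Context {R : realType} {K C : nat} {A : 'I_K -> nat}.
Variables (lambda gamma mu : 'I_K -> R).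
Implicit Types (y : state C A -> R) (n : state C A).

Definition mean_occ (k : 'I_K) y : R := \sum_m (occ m k)%:R * y m.

Definition vector_field y n : R :=
  \sum_k (lambda k + gamma k * mean_occ k y) *
         (oapp y 0 (minus_f n k) - y n * (isSome (plus_f n k))%:R)
  + \sum_k (gamma k + mu k) *
         ((occ n k).+1%:R * oapp y 0 (plus_f n k) - (occ n k)%:R * y n).

Definition equilibrium y : Prop := forall n, vector_field y n = 0.

End VectorField.

(* The states of the network are encoded by the numbers c n = N y_n of nodes in
   state n. *)
Definition netstate (K C : nat) (A : 'I_K -> nat) (N : nat) : finType :=
  {c : {ffun state C A -> 'I_N.+1} | (\sum_n c n == N)%N}.

Section Chain.
Context {R : realType} {K C : nat} {A : 'I_K -> nat}.
Variables (lambda gamma mu : 'I_K -> R) (N : nat).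
Implicit Types (y z : state C A -> R) (c d : netstate C A N).

Definition emp c : state C A -> R := fun n => (val c n)%:R / N%:R.

Definition evec (o : option (state C A)) : state C A -> R :=
  fun x => (o == Some x)%:R.

Definition ind_eq y z : R := [forall x, y x == z x]%:R.

(* Total rate of the transitions from y leading to z. A transition whose
   target involves a nonexistent n - f_k has rate 0. *)
Definition jump_rate y z : R :=
  \sum_n \sum_k
    lambda k * N%:R * y n * (isSome (plus_f n k))%:R *
    ind_eq z (fun x => y x + N%:R^-1 * (evec (plus_f n k) x - evec (Some n) x))
  + \sum_n \sum_k
    mu k * (occ n k)%:R * N%:R * y n *
    ind_eq z (fun x => y x + N%:R^-1 * (evec (minus_f n k) x - evec (Some n) x))
  + \sum_n \sum_m \sum_k
    gamma k * N%:R / (N%:R - 1) * (occ n k)%:R * y n *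
      (N%:R * y m - (m == n)%:R) *
    ind_eq z (fun x => y x
      + N%:R^-1 * (evec (minus_f n k) x - evec (Some n) x)
      + N%:R^-1 * (evec (plus_f m k) x - evec (Some m) x) * (isSome (plus_f m k))%:R).

Definition generator c d : R :=
  if c == d then - \sum_(d' | d' != c) jump_rate (emp c) (emp d')
  else jump_rate (emp c) (emp d).

Definition generator_pow (j : nat) : netstate C A N -> netstate C A N -> R :=
  iter j (fun P c d => \sum_e generator c e * P e d) (fun c d => (c == d)%:R).

(* entries of exp(t Q), Q being the generator *)
Definition semigroup (t : R) c d : R :=
  limn (series (fun j => t ^+ j / j`!%:R * generator_pow j c d)).

End Chain.

Definition borel (T : ptopologicalType) := g_sigma_algebraType (@open T).

Definition weak_cvg (R : realType) (T : ptopologicalType)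
    (nu_ : nat -> {finite_measure set (borel T) -> \bar R})
    (nu : {finite_measure set (borel T) -> \bar R}) : Prop :=
  forall f : T -> R, continuous f -> bounded_fun f ->
    (\int[nu_ j]_x f x) @[j --> \oo] --> \int[nu]_x f x.

Definition limiting_point (R : realType) (T : ptopologicalType)
    (nu_ : nat -> {finite_measure set (borel T) -> \bar R})
    (nu : {finite_measure set (borel T) -> \bar R}) : Prop :=
  exists phi : nat -> nat,
    (forall i j, (i < j)%N -> (phi i < phi j)%N) /\
    weak_cvg (fun j => nu_ (phi j)) nu.

(* The second conjunct says that pi P_t = pi for the transition semigroup
   (P_t) of (Y^N(t)). *)
Definition invariant_distribution (R : realType) (K C : nat) (A : 'I_K -> nat)
    (lambda gamma mu : 'I_K -> R) (N : nat)
    (pi : probability (borel (pvec R C A)) R) : Prop :=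
  let atom (c : netstate C A N) := [set y : pvec R C A | pcoord y = emp c] in
  pi [set y : pvec R C A | exists c : netstate C A N, pcoord y = emp c] = 1%E /\
  (forall t : R, 0 <= t -> forall d : netstate C A N,
     (\sum_c pi (atom c) * (semigroup lambda gamma mu t c d)%:E)%E = pi (atom d)).

(* Main.v *)
Require Import Defs.
From mathcomp Require Import all_boot all_order all_algebra.
From mathcomp Require Import all_classical all_reals all_analysis.
From mathcomp Require Import measurable_realfun ring lra zify.

Set Implicit Arguments.
Unset Strict Implicit.
Unset Printing Implicit Defensive.

Import Order.TTheory GRing.Theory Num.Theory.
Import numFieldNormedType.Exports.

Local Open Scope classical_set_scope.
Local Open Scope ring_scope.

(** Freeze the mean occupations at y. Then V(y) is the master equation of a
    reversible chain on the node states, which goes from n to n + f_k at rate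
    L_k = lambda_k + gamma_k <I_k, y> and back at rate
    (gamma_k + mu_k) (n_k + 1). Let [edge_flow] be the net flux
    L_k y_n - (gamma_k + mu_k) (n_k + 1) y_(n + f_k) through an edge, and
    [imbalance] the sum H(y) of its squares. Detailed balance implies
    stationarity: V(y) = 0 as soon as H(y) = 0 ([imbalance_eq0]). Hence it is
    enough to prove that the mean of H under pi_N tends to 0
    ([mean_imbalance_cvg0]).

    The tool is the Lyapunov function
      g(y) = sum_n y_n ln (n! y_n)
        - sum_k int_0^<I_k, y> ln ((lambda_k + gamma_k x) / (gamma_k + mu_k)) dx.
    The difference of its partial derivatives along an edge is ln (b / a), where
    a and b are the forward and backward fluxes, so that <V, grad g> is minus
    the sum of the terms (a - b) ln (a / b) >= 0. Moving y_n to y_n + e inside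
    the logarithm removes the singularity of g at the boundary of the simplex,
    and costs only O(e): for some constant M,
      (a - b) (ln a_e - ln b_e) >= (a - b)^2 / M - M e   ([log_dissipation]).

    The stationary equation pi_N exp(tQ) = pi_N gives pi_N Q = 0 by expansion
    at t = 0 ([stationary_generator]). The generator applied to g is
    <V, grad g> up to O(1 / (N e)), the error coming from the convexity of
    u ln u ([lyapunov_step]) and from the difference between N and N - 1 in the
    internal moves. Therefore
      0 = E_N (Q g) <= - E_N (H) / M + W (e + 1 / (N e))   ([lyapunov_drift]),
    and E_N (H) tends to 0 on choosing e small and then N large.

    If pi_(phi j) converges weakly to nu, then nu (H) = 0, so that nu is carried
    by {H = 0}, a subset of {V = 0}. If y_inf is the only equilibrium, then H
    is positive off y_inf and, the simplex being compact, a continuous f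
    satisfies |f - f(y_inf)| <= eta + L H for every eta > 0 and some L
    ([dominated_by_imbalance]); integrating against pi_N gives the convergence
    to the Dirac mass. *)

(** * Neighbouring node states and configurations of the network *)

Section Neighbours.
Context {K C : nat} {A : 'I_K -> nat}.
Implicit Types n m : state C A.

Lemma occ_inj n m : (forall i, occ n i = occ m i) -> n = m.
Proof. by move=> h; apply/val_inj/ffunP => i; apply/val_inj/h. Qed.

Lemma occ_le n k : (occ n k <= C)%N.
Proof. by rewrite -ltnS; exact: ltn_ord. Qed.

Lemma plus_fP n m k :
  reflect (forall i, occ m i = occ n i + (i == k))%N (plus_f n k == Some m).
Proof.
rewrite /plus_f; case: pickP => [m' /forallP h|h]; apply: (iffP eqP).
- by case=> <- i; exact/eqP/h.
- by move=> hm; congr Some; apply: occ_inj => i; rewrite hm; exact/eqP/h.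
- by [].
- by move=> hm; have /forallP[] := negbT (h m) => i; apply/eqP.
Qed.

Lemma minus_fP n m k :
  reflect (forall i, occ n i = occ m i + (i == k))%N (minus_f n k == Some m).
Proof.
rewrite /minus_f; case: pickP => [m' /forallP h|h]; apply: (iffP eqP).
- by case=> <- i; exact/eqP/h.
- move=> hm; congr Some; apply: occ_inj => i; apply: (@addIn (i == k)).
  by rewrite -hm; exact/esym/eqP/h.
- by [].
- by move=> hm; have /forallP[] := negbT (h m) => i; apply/eqP.
Qed.

Lemma plus_minus_f n m k : (plus_f n k == Some m) = (minus_f m k == Some n).
Proof. by apply/plus_fP/minus_fP. Qed.

Lemma minus_f_exists n k : (0 < occ n k)%N -> isSome (minus_f n k).
Proof.
move=> n_gt0.
pose d : {ffun 'I_K -> 'I_C.+1} := [ffun i => inord (occ n i - (i == k))].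
have dE i : d i = (occ n i - (i == k))%N :> nat.
  by rewrite ffunE inordK // ltnS (leq_trans (leq_subr _ _) (occ_le n i)).
have d_le : (\sum_i A i * d i <= C)%N.
  apply: leq_trans (valP n); apply: leq_sum => i _.
  by rewrite leq_mul2l dE leq_subr orbT.
pose m : state C A :=
  exist (fun n : {ffun 'I_K -> 'I_C.+1} => (\sum_k A k * n k <= C)%N) d d_le.
suff /eqP -> : minus_f n k == Some m by [].
apply/minus_fP => i; rewrite /occ /= dE /occ subnK //.
by case: eqP => [->|//].
Qed.

Lemma minus_f_none n k : minus_f n k = None -> occ n k = 0%N.
Proof.
move=> h; apply/eqP; rewrite -leqn0 leqNgt; apply/negP => /minus_f_exists.
by rewrite h.
Qed.

Lemma occ_plus n m k : plus_f n k = Some m -> occ m k = (occ n k).+1.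
Proof. by move/eqP/plus_fP/(_ k); rewrite eqxx addn1. Qed.

Lemma oapp_sum (R : pzRingType) (F : state C A -> R) (o : option (state C A)) :
  oapp F 0 o = \sum_m (o == Some m)%:R * F m.
Proof.
case: o => [n|]; last by rewrite /= big1 // => m _; rewrite mul0r.
rewrite (bigD1 n) //= eqxx mul1r big1 ?addr0 // => m /negPf nm.
by rewrite -[Some n == _]/(n == m) eq_sym nm mul0r.
Qed.

(** Each pair of neighbouring states can be listed from either end. *)
Lemma sum_minus_plus (R : pzRingType) (F : state C A -> state C A -> R) k :
  \sum_n oapp (F n) 0 (minus_f n k) =
  \sum_n oapp (fun m => F m n) 0 (plus_f n k).
Proof.
under eq_bigr do rewrite oapp_sum.
rewrite exchange_big; apply: eq_bigr => n _.
by rewrite oapp_sum; apply: eq_bigr => m _; rewrite plus_minus_f.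
Qed.

End Neighbours.

Section Configurations.
Context {R : realType} {K C : nat} {A : 'I_K -> nat} (N : nat).
Implicit Types c d : netstate C A N.

Definition cnt c (n : state C A) : nat := val c n.

Lemma sum_cnt c : (\sum_n cnt c n)%N = N.
Proof. exact/eqP/(valP c). Qed.

(** The bound by N on each count follows from the total. *)
Lemma netstate_of (f : state C A -> nat) :
  (\sum_n f n)%N = N -> exists c, forall n, cnt c n = f n.
Proof.
move=> fN.
have f_le n : (f n < N.+1)%N by rewrite ltnS -fN (bigD1 n) //= leq_addr.
pose d : {ffun state C A -> 'I_N.+1} := [ffun n => Ordinal (f_le n)].
have dN : (\sum_n d n == N)%N.
  by apply/eqP/(etrans _ fN)/eq_bigr => n _; rewrite ffunE.
exists (exist (fun c : {ffun state C A -> 'I_N.+1} => (\sum_n c n == N)%N) d dN).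
by move=> n; rewrite /cnt /= ffunE.
Qed.

Hypothesis N_gt0 : (0 < N)%N.

Lemma emp_inj c d : (forall n, emp c n = emp d n :> R) -> c = d.
Proof.
move=> h; apply/val_inj/ffunP => n; apply/val_inj/eqP.
have N0 : N%:R^-1 != 0 :> R by rewrite invr_eq0 pnatr_eq0 -lt0n.
by rewrite -(eqr_nat R); apply/eqP/(mulIf N0)/h.
Qed.

Lemma emp_ge0 c n : 0 <= emp c n :> R.
Proof. by rewrite divr_ge0. Qed.

Lemma sum_emp c : \sum_n emp c n = 1 :> R.
Proof.
by rewrite -mulr_suml -natr_sum sum_cnt divff // pnatr_eq0 -lt0n.
Qed.

Lemma emp_neq0 c n : emp c n != 0 :> R -> (0 < cnt c n)%N.
Proof.
by rewrite lt0n; apply: contraNneq => c0; rewrite /emp -/(cnt c n) c0 mul0r.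
Qed.

Lemma emp_le1 c n : emp c n <= 1 :> R.
Proof.
rewrite -(sum_emp c) (bigD1 n) //= lerDl sumr_ge0 // => m _; exact: emp_ge0.
Qed.

Lemma cnt_emp c n : (cnt c n)%:R = N%:R * emp c n :> R.
Proof. by rewrite mulrC divfK // pnatr_eq0 -lt0n. Qed.

(** A node in state n can be turned into one in state p; every transition of
    the network is made of one or two such replacements. *)
Lemma move_node c n p : (0 < cnt c n)%N ->
  exists2 d, (forall x, cnt d x + (n == x) = cnt c x + (p == x))%N &
    forall x,
      emp d x = emp c x + (N%:R^-1 : R) * (evec (Some p) x - evec (Some n) x).
Proof.
move=> cn_gt0; pose f x := (cnt c x + (p == x) - (n == x))%N.
have fE x : (f x + (n == x) = cnt c x + (p == x))%N.
  rewrite /f subnK //; case: eqP => [<-|//].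
  by rewrite (leq_trans cn_gt0) // leq_addr.
have sum_delta (q : state C A) : (\sum_x (q == x) = 1)%N.
  by rewrite (bigD1 q) //= eqxx big1 // => x /negPf; rewrite eq_sym => ->.
have [|d dE] := @netstate_of f.
  have : (\sum_x (f x + (n == x)) = \sum_x (cnt c x + (p == x)))%N.
    exact: eq_bigr.
  by rewrite !big_split /= !sum_delta sum_cnt => /addIn.
exists d => x; first by rewrite dE fE.
have /(congr1 (fun i => i%:R : R)) := fE x.
rewrite -dE !natrD => h.
have -> : emp d x = N%:R^-1 * (cnt d x)%:R :> R by rewrite mulrC.
have -> : emp c x = N%:R^-1 * (cnt c x)%:R :> R by rewrite mulrC.
rewrite -mulrDr /evec; congr (_ * _).
rewrite !(inj_eq Some_inj) in h *.
lra.
Qed.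

End Configurations.

(** * Inequalities for the logarithm *)

Section Entropy.
Context {R : realType}.
Implicit Types u v : R.

Definition ln_primitive u : R := u * ln u - u.

Lemma ln_le u : 0 < u -> ln u <= u - 1.
Proof.
move=> u_gt0; rewrite -[u in ln u](subrK 1) addrC le_ln1Dx //.
by rewrite ltrBrDr addrC subrr.
Qed.

Lemma lnB_le u v : 0 < u -> 0 < v -> ln v - ln u <= (v - u) / u.
Proof.
move=> u_gt0 v_gt0; rewrite -ln_div ?posrE // mulrBl divff ?gt_eqF //.
by apply: ln_le; rewrite divr_gt0.
Qed.

Lemma lnB_ge u v : 0 < u -> 0 < v -> (v - u) / v <= ln v - ln u.
Proof.
move=> u_gt0 v_gt0; rewrite -lerN2 opprB -mulNr opprB; exact: lnB_le.
Qed.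

(** The two tangent inequalities of a convex function whose derivative is the
    logarithm. *)
Lemma ln_primitive_sub_le u v : 0 < u -> 0 < v ->
  ln_primitive v - ln_primitive u <= (v - u) * ln v.
Proof.
move=> u_gt0 v_gt0; rewrite /ln_primitive.
have : u * (ln v - ln u) <= v - u.
  by rewrite mulrC -ler_pdivlMr //; exact: lnB_le.
lra.
Qed.

Lemma ln_primitive_sub_ge u v : 0 < u -> 0 < v ->
  (v - u) * ln u <= ln_primitive v - ln_primitive u.
Proof.
by move=> u_gt0 v_gt0; have := ln_primitive_sub_le v_gt0 u_gt0; lra.
Qed.

Lemma ln_abs_le u : 0 < u -> `|ln u| <= u + u^-1.
Proof.
move=> u_gt0; have ui_gt0 : 0 < u^-1 by rewrite invr_gt0.
have := ln_le u_gt0; have := ln_le ui_gt0; rewrite lnV ?posrE //.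
by move=> h1 h2; rewrite ler_norml; apply/andP; split; lra.
Qed.

(** With forward flux a x and backward flux b y through an edge, the term
    (a x - b y) ln (a x / b y) of the entropy dissipation is at least
    (a x - b y)^2 / M. Shifting x and y by e keeps both logarithms finite, but
    the sign of the logarithm may then be wrong when a x and b y are within
    O(e) of each other: this is the loss M e. *)
Lemma log_dissipation (M e x y a b : R) :
  0 < e -> e <= 1 -> 0 <= x <= 1 -> 0 <= y <= 1 ->
  0 < a -> 2 * a <= M -> 0 < b -> 2 * b <= M ->
  (a * x - b * y) ^+ 2 / M - M * e <=
  (a * x - b * y) * (ln (a * (x + e)) - ln (b * (y + e))).
Proof.
wlog le_ba : a b x y / b * y <= a * x => [wl|].
  move=> e_gt0 e_le1 x01 y01 a_gt0 aM b_gt0 bM.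
  have [le|/ltW le] := leP (b * y) (a * x); first exact: wl.
  by have := wl b a y x le e_gt0 e_le1 y01 x01 b_gt0 bM a_gt0 aM; lra.
(* From here on b y <= a x, and ln p - ln q >= (p - q) / p suffices. *)
move=> e_gt0 e_le1 /andP[x_ge0 x_le1] /andP[y_ge0 y_le1] a_gt0 aM b_gt0 bM.
set p := a * (x + e); set q := b * (y + e); set d := a * x - b * y.
have d_ge0 : 0 <= d by rewrite subr_ge0.
have p_gt0 : 0 < p by rewrite mulr_gt0 // ltr_wpDl.
have q_gt0 : 0 < q by rewrite mulr_gt0 // ltr_wpDl.
have p_le : p <= M.
  by apply: le_trans aM; rewrite /p mulrC ler_wpM2r ?(ltW a_gt0) //; lra.
have dp : d <= p.
  have := mulr_ge0 (ltW b_gt0) y_ge0; have := mulr_ge0 (ltW a_gt0) (ltW e_gt0).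
  by rewrite /d /p; lra.
have M_gt0 : 0 < M by exact: lt_le_trans p_le.
apply: le_trans (ler_wpM2l d_ge0 (lnB_ge q_gt0 p_gt0)).
have -> : d * ((p - q) / p) = d ^+ 2 / p + d / p * ((a - b) * e).
  have -> : p - q = d + (a - b) * e by rewrite /p /q /d; ring.
  by ring.
apply: lerD.
  by apply: ler_wpM2l; [exact: sqr_ge0|rewrite lef_pV2 ?posrE].
have dp01 : 0 <= d / p <= 1.
  by rewrite divr_ge0 ?(ltW p_gt0) //= ler_pdivrMr // mul1r.
have : - (M * e) <= (a - b) * e by rewrite -mulNr ler_wpM2r ?(ltW e_gt0) //; lra.
have : 0 <= M * e by rewrite mulr_ge0 ?ltW.
case/andP: dp01 => [r0 r1] me h.
apply: le_trans (ler_wpM2l r0 h).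
by nra.
Qed.

End Entropy.

(** * The Lyapunov function *)

Section Lyapunov.
Context {R : realType} {K C : nat} {A : 'I_K -> nat}.
Variables (lambda gamma mu : 'I_K -> R).
Hypothesis lambda_gt0 : forall k, 0 < lambda k.
Hypothesis gamma_gt0 : forall k, 0 < gamma k.
Hypothesis mu_ge0 : forall k, 0 <= mu k.
Implicit Types (y z : state C A -> R) (n m : state C A) (k : 'I_K) (e : R).

Definition arrival_rate k y : R := lambda k + gamma k * mean_occ k y.

Definition departure_rate n k : R := (gamma k + mu k) * (occ n k).+1%:R.

(** Net flux from n to n + f_k in the master equation with mean occupations
    frozen at y. *)
Definition edge_flow y n k : R :=
  arrival_rate k y * y n - departure_rate n k * oapp y 0 (plus_f n k).

Definition imbalance y : R :=
  \sum_n \sum_k (isSome (plus_f n k))%:R * edge_flow y n k ^+ 2.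

Lemma imbalance_ge0 y : 0 <= imbalance y.
Proof.
by apply: sumr_ge0 => n _; apply: sumr_ge0 => k _; rewrite mulr_ge0 ?sqr_ge0.
Qed.

(** Detailed balance implies stationarity: V_n is the sum of the net fluxes into
    n minus the sum of those out of n. *)
Lemma imbalance_eq0 y : imbalance y = 0 -> equilibrium lambda gamma mu y.
Proof.
move=> /eqP H0.
have flow0 n m k : plus_f n k = Some m ->
    arrival_rate k y * y n = departure_rate n k * y m.
  move=> nm; move: H0; rewrite psumr_eq0; last first.
    by move=> p _; apply: sumr_ge0 => i _; rewrite mulr_ge0 ?sqr_ge0.
  move=> /allP /(_ n (mem_index_enum _)); rewrite psumr_eq0; last first.
    by move=> i _; rewrite mulr_ge0 ?sqr_ge0.
  move=> /allP /(_ k (mem_index_enum _)).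
  by rewrite /edge_flow nm mul1r sqrf_eq0 subr_eq0 => /eqP.
move=> n; rewrite /vector_field -big_split big1 //= => k _.
rewrite -/(arrival_rate k y) !mulrBr.
have -> : arrival_rate k y * oapp y 0 (minus_f n k) =
    (gamma k + mu k) * ((occ n k)%:R * y n).
  case E : (minus_f n k) => [m|] /=.
    have /eqP mn : plus_f m k == Some n by rewrite plus_minus_f E.
    by rewrite (flow0 _ _ _ mn) (occ_plus mn) mulrA.
  by rewrite (minus_f_none E) !(mul0r, mulr0).
have -> : arrival_rate k y * (y n * (isSome (plus_f n k))%:R) =
    (gamma k + mu k) * ((occ n k).+1%:R * oapp y 0 (plus_f n k)).
  case E : (plus_f n k) => [m|] /=; last by rewrite !mulr0.
  by rewrite mulr1 (flow0 _ _ _ E) mulrA.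
ring.
Qed.

Lemma mean_occ_ge0 k y : (forall n, 0 <= y n) -> 0 <= mean_occ k y.
Proof. by move=> y0; apply: sumr_ge0 => n _; rewrite mulr_ge0. Qed.

Lemma mean_occ_le k y :
  (forall n, 0 <= y n) -> \sum_n y n = 1 -> mean_occ k y <= C%:R.
Proof.
move=> y0 y1; rewrite -[leRHS]mulr1 -[X in _ <= _ * X]y1 mulr_sumr.
by apply: ler_sum => n _; rewrite ler_wpM2r // ler_nat occ_le.
Qed.

Lemma arrival_rate_ge k y : (forall n, 0 <= y n) -> lambda k <= arrival_rate k y.
Proof. by move=> y0; rewrite lerDl mulr_ge0 ?mean_occ_ge0 // ltW. Qed.

Lemma arrival_rate_gt0 k y : (forall n, 0 <= y n) -> 0 < arrival_rate k y.
Proof. by move=> /(arrival_rate_ge k); apply: lt_le_trans. Qed.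

Lemma departure_rate_gt0 n k : 0 < departure_rate n k.
Proof. by rewrite mulr_gt0 ?ltr0n // ltr_wpDr. Qed.

(** Minus the logarithm of prod_k (gamma_k + mu_k)^(- n_k) / n_k!, the part of
    the reversible measure that does not depend on y. *)
Definition weight n : R :=
  \sum_k (ln (occ n k)`!%:R + (occ n k)%:R * ln (gamma k + mu k)).

(** The free energy of the frozen dynamics, regularized by e at the boundary of
    the simplex; the integrals of ln (lambda_k + gamma_k x) are written in
    closed form, up to a constant. *)
Definition lyapunov e y : R :=
  \sum_n (ln_primitive (y n + e) + y n * weight n)
  - \sum_k (gamma k)^-1 * ln_primitive (arrival_rate k y).

(** Partial derivatives of [lyapunov e]. *)
Definition gradient e y n : R :=
  ln (y n + e) + weight n - \sum_k (occ n k)%:R * ln (arrival_rate k y).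

Lemma gradient_plus e y n m k : 0 < e -> (forall x, 0 <= y x) ->
  plus_f n k = Some m ->
  gradient e y m - gradient e y n =
  ln (departure_rate n k * (y m + e)) - ln (arrival_rate k y * (y n + e)).
Proof.
move=> e_gt0 y0 nm.
have occE i : occ m i = (occ n i + (i == k))%N by move/eqP/plus_fP: nm.
have ye x : 0 < y x + e by rewrite ltr_wpDl.
have a_gt0 := arrival_rate_gt0 k y0.
have gm : 0 < gamma k + mu k by rewrite ltr_wpDr.
rewrite /gradient /departure_rate !lnM ?posrE ?mulr_gt0 ?ltr0n //.
have -> : weight m = weight n + ln (gamma k + mu k) + ln (occ n k).+1%:R.
  rewrite /weight (bigD1 k) //= [in RHS](bigD1 k) //= occE eqxx addn1 factS.
  rewrite natrM lnM ?posrE ?ltr0n ?fact_gt0 // -natr1 mulrDl mul1r.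
  set s1 := \sum_(i | _) _; set s2 := \sum_(i | _) _.
  suff -> : s1 = s2 by ring.
  by apply: eq_bigr => i /negPf ik; rewrite occE ik addn0.
have -> : \sum_i (occ m i)%:R * ln (arrival_rate i y) =
    \sum_i (occ n i)%:R * ln (arrival_rate i y) + ln (arrival_rate k y).
  rewrite (bigD1 k) //= [in RHS](bigD1 k) //= occE eqxx addn1 -natr1.
  set s1 := \sum_(i | _) _; set s2 := \sum_(i | _) _.
  suff -> : s1 = s2 by ring.
  by apply: eq_bigr => i /negPf ik; rewrite occE ik addn0.
ring.
Qed.

Lemma ln_variation_le e u v : 0 < e -> e <= u -> e <= v ->
  (v - u) * (ln v - ln u) <= (v - u) ^+ 2 / e.
Proof.
wlog uv : u v / u <= v => [wl|] e_gt0 eu ev.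
  have [|/ltW vu] := leP u v; first by move=> uv; exact: wl.
  by have := wl _ _ vu e_gt0 ev eu; rewrite !expr2; lra.
have u_gt0 := lt_le_trans e_gt0 eu; have v_gt0 := lt_le_trans e_gt0 ev.
rewrite expr2 -mulrA ler_wpM2l ?subr_ge0 //.
apply: le_trans (lnB_le u_gt0 v_gt0) _.
by rewrite ler_wpM2l ?subr_ge0 // lef_pV2 ?posrE.
Qed.

(** A second-order expansion with explicit remainder. The entropy part is
    convex, with second derivative at most 1 / e; the interaction part is
    concave and therefore contributes no remainder to an upper bound. *)
Lemma lyapunov_step e y z : 0 < e ->
  (forall n, 0 <= y n) -> (forall n, 0 <= z n) ->
  lyapunov e z - lyapunov e y <=
  \sum_n (z n - y n) * gradient e y n + (\sum_n (z n - y n) ^+ 2) / e.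
Proof.
move=> e_gt0 y0 z0.
have ve x (w : state C A -> R) : (forall n, 0 <= w n) -> 0 < w x + e.
  by move=> w0; rewrite ltr_wpDl.
have entropy n : ln_primitive (z n + e) - ln_primitive (y n + e) <=
    (z n - y n) * ln (y n + e) + (z n - y n) ^+ 2 / e.
  have := ln_primitive_sub_le (ve n y y0) (ve n z z0).
  have ey : e <= y n + e by rewrite lerDr.
  have ez : e <= z n + e by rewrite lerDr.
  have := ln_variation_le e_gt0 ey ez.
  have -> : z n + e - (y n + e) = z n - y n by ring.
  lra.
have arrivals k : (\sum_n (z n - y n) * ((occ n k)%:R * ln (arrival_rate k y))) <=
    (gamma k)^-1 * ln_primitive (arrival_rate k z)
    - (gamma k)^-1 * ln_primitive (arrival_rate k y).
  rewrite -mulrBr; apply: le_trans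
    (ler_wpM2l _ (ln_primitive_sub_ge (arrival_rate_gt0 k y0)
      (arrival_rate_gt0 k z0))); last first.
    by rewrite invr_ge0 ltW.
  have -> : arrival_rate k z - arrival_rate k y =
      gamma k * \sum_n (z n - y n) * (occ n k)%:R.
    rewrite /arrival_rate opprD addrACA subrr add0r -mulrBr; congr (_ * _).
    by rewrite /mean_occ -sumrB; apply: eq_bigr => n _; ring.
  rewrite !mulrA mulVf ?gt_eqF // mul1r mulr_suml.
  by apply: ler_sum => n _; rewrite mulrA.
have -> : \sum_n (z n - y n) * gradient e y n =
    \sum_n ((z n - y n) * ln (y n + e) + (z n - y n) * weight n)
    - \sum_k \sum_n (z n - y n) * ((occ n k)%:R * ln (arrival_rate k y)).
  rewrite exchange_big -sumrB; apply: eq_bigr => n _ /=.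
  by rewrite -mulr_sumr /gradient; ring.
have h1 := @ler_sum _ _ (index_enum _) xpredT _ _ (fun k _ => arrivals k).
have h2 := @ler_sum _ _ (index_enum _) xpredT _ _ (fun n _ => entropy n).
rewrite sumrB in h1; rewrite sumrB [leRHS]big_split /= -mulr_suml in h2.
have lyapunovE (w : state C A -> R) : lyapunov e w =
    \sum_n ln_primitive (w n + e) + \sum_n w n * weight n
    - \sum_k (gamma k)^-1 * ln_primitive (arrival_rate k w).
  by rewrite /lyapunov big_split.
rewrite !lyapunovE [in leRHS]big_split /=.
have -> : \sum_n (z n - y n) * weight n =
    \sum_n z n * weight n - \sum_n y n * weight n.
  by rewrite -sumrB; apply: eq_bigr => n _; ring.
lra.
Qed.

End Lyapunov.

(** * Drift of the Lyapunov function along the network *)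

Section Drift.
Context {R : realType} {K C : nat} {A : 'I_K -> nat}.
Variables (lambda gamma mu : 'I_K -> R).
Hypothesis lambda_gt0 : forall k, 0 < lambda k.
Hypothesis gamma_gt0 : forall k, 0 < gamma k.
Hypothesis mu_ge0 : forall k, 0 <= mu k.

Lemma generator_sum (N : nat) (F : (state C A -> R) -> R) (c : netstate C A N) :
  \sum_(d : netstate C A N) generator lambda gamma mu c d * F (emp d) =
  \sum_(d : netstate C A N) jump_rate lambda gamma mu N (emp c) (emp d)
    * (F (emp d) - F (emp c)).
Proof.
rewrite (bigD1 c) //= [RHS](bigD1 c) //= subrr mulr0 add0r.
rewrite /generator eqxx mulNr mulr_suml -sumrN -big_split /=.
apply: eq_bigr => d dc.
by rewrite eq_sym (negPf dc); ring.
Qed.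

(** Contribution of one transition y -> z of rate r to the generator. The target
    must be a configuration when r is nonzero, because b may be negative. *)
Lemma jump_sum_le (N : nat) (F : (state C A -> R) -> R) (c : netstate C A N)
    (r b : R) (z : state C A -> R) : (0 < N)%N -> 0 <= r ->
  (r != 0 -> exists d : netstate C A N, forall x, emp d x = z x) ->
  (forall d : netstate C A N, (forall x, emp d x = z x) ->
     F (emp d) - F (emp c) <= b) ->
  \sum_(d : netstate C A N) r * ind_eq (emp d) z * (F (emp d) - F (emp c)) <=
  r * b.
Proof.
move=> N_gt0 r_ge0 ex_d le_b.
under eq_bigr do rewrite -mulrA.
rewrite -mulr_sumr.
have [->|r_neq0] := eqVneq r 0; first by rewrite !mul0r.
have [d0 d0z] := ex_d r_neq0.
apply: ler_wpM2l => //.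
rewrite (bigD1 d0) //= big1 ?addr0 => [|d dd0].
  rewrite /ind_eq; have -> : [forall x, emp d0 x == z x].
    by apply/forallP => x; rewrite d0z.
  by rewrite mul1r; exact: le_b.
rewrite /ind_eq; case: forallP => [dz|]; last by rewrite mul0r.
case/eqP: dd0; apply: (@emp_inj R) => // x.
by rewrite d0z; apply/eqP.
Qed.

Lemma evec_sum (G : state C A -> R) (o p : option (state C A)) :
  \sum_x (evec o x - evec p x) * G x = oapp G 0 o - oapp G 0 p.
Proof. by rewrite !oapp_sum -sumrB; apply: eq_bigr => x _; rewrite mulrBl. Qed.

Lemma evec_diff (o p : option (state C A)) x :
  `|evec o x - evec p x : R| <= 1.
Proof.
rewrite /evec; case: (o == _); case: (p == _);
  by rewrite ?subrr ?subr0 ?sub0r ?normrN ?normr1 ?normr0.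
Qed.

Local Notation lyap := (lyapunov lambda gamma mu).
Local Notation grad := (gradient lambda gamma mu).
Local Notation NX := (#|{: state C A}|%:R : R).

(** The displacement D is the net change of the counts, at most 2 in each
    coordinate since at most two nodes change state. *)
Lemma lyapunov_jump (N : nat) e (c : netstate C A N) (z D : state C A -> R) :
  (0 < N)%N -> 0 < e ->
  (forall x, z x = emp c x + D x / N%:R) -> (forall x, `|D x| <= 2) ->
  forall d : netstate C A N, (forall x, emp d x = z x) ->
  lyap e (emp d) - lyap e (emp c) <=
  (\sum_x D x * grad e (emp c) x) / N%:R + 4 * NX / (N%:R ^+ 2 * e).
Proof.
move=> N_gt0 e_gt0 zE D2 d dz.
have dE x : emp d x - emp c x = D x / N%:R by rewrite dz zE addrC addKr.
have := lyapunov_step mu lambda_gt0 gamma_gt0 e_gt0 (emp_ge0 c) (emp_ge0 d).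
move/le_trans; apply.
apply: lerD.
  by rewrite mulr_suml; apply: ler_sum => x _; rewrite dE mulrAC.
rewrite invfM mulrA ler_wpM2r ?invr_ge0 ?(ltW e_gt0) //.
have -> : 4 * NX / N%:R ^+ 2 = \sum_(x : state C A) 4 / N%:R ^+ 2.
  by rewrite sumr_const mulrAC mulr_natr.
apply: ler_sum => x _; rewrite dE expr_div_n.
rewrite ler_wpM2r ?invr_ge0 ?exprn_ge0 //.
rewrite -real_normK ?num_real // (_ : 4 = 2 ^+ 2); last by ring.
by rewrite lerXn2r ?nnegrE.
Qed.

(** Increments of the gradient along the edges above and below n. *)
Definition rise e (y : state C A -> R) n k : R :=
  oapp (fun m => grad e y m - grad e y n) 0 (plus_f n k).

Definition fall e (y : state C A -> R) n k : R :=
  oapp (fun m => grad e y m - grad e y n) 0 (minus_f n k).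

(** Listing a departure at the lower end of its edge makes it combine with the
    arrivals through the same edge into a net flux. *)
Lemma sum_fall e (y : state C A -> R) k :
  \sum_n (occ n k)%:R * y n * fall e y n k =
  - \sum_n (occ n k).+1%:R * oapp y 0 (plus_f n k) * rise e y n k.
Proof.
pose F n m := (occ n k)%:R * y n * (grad e y m - grad e y n).
have -> : \sum_n (occ n k)%:R * y n * fall e y n k =
    \sum_n oapp (F n) 0 (minus_f n k).
  by apply: eq_bigr => n _; rewrite /fall; case: (minus_f n k); rewrite //= mulr0.
rewrite sum_minus_plus -sumrN; apply: eq_bigr => n _; rewrite /rise /F.
case nm : (plus_f n k) => [m|] /=; last by rewrite mulr0 oppr0.
by rewrite (occ_plus nm); ring.
Qed.

Lemma external_arrival (N : nat) e (c : netstate C A N) n k :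
  (0 < N)%N -> 0 < e ->
  \sum_(d : netstate C A N)
    lambda k * N%:R * emp c n * (isSome (plus_f n k))%:R *
    ind_eq (emp d)
      (fun x => emp c x + N%:R^-1 * (evec (plus_f n k) x - evec (Some n) x)) *
    (lyap e (emp d) - lyap e (emp c)) <=
  lambda k * N%:R * emp c n * (isSome (plus_f n k))%:R *
    (rise e (emp c) n k / N%:R + 4 * NX / (N%:R ^+ 2 * e)).
Proof.
move=> N_gt0 e_gt0.
case nm : (plus_f n k) => [m|] /=; last first.
  by rewrite mulr0 mul0r big1 // => d _; rewrite !mul0r.
rewrite /rise nm /= mulr1.
apply: jump_sum_le => //.
- by rewrite !mulr_ge0 ?emp_ge0 // ltW.
- rewrite mulf_eq0 negb_or => /andP[_ /emp_neq0 cn_gt0].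
  by have [d _ dE] := @move_node R _ _ _ N c n m cn_gt0; exists d.
- have := @lyapunov_jump N e c _ (fun x => evec (Some m) x - evec (Some n) x).
  rewrite evec_sum; apply => // [x|x]; first by rewrite mulrC.
  by apply: le_trans (evec_diff _ _ _) _; rewrite ler1n.
Qed.

Lemma external_departure (N : nat) e (c : netstate C A N) n k :
  (0 < N)%N -> 0 < e ->
  \sum_(d : netstate C A N)
    mu k * (occ n k)%:R * N%:R * emp c n *
    ind_eq (emp d)
      (fun x => emp c x + N%:R^-1 * (evec (minus_f n k) x - evec (Some n) x)) *
    (lyap e (emp d) - lyap e (emp c)) <=
  mu k * (occ n k)%:R * N%:R * emp c n *
    (fall e (emp c) n k / N%:R + 4 * NX / (N%:R ^+ 2 * e)).
Proof.
move=> N_gt0 e_gt0.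
case nm : (minus_f n k) => [m|] /=; last first.
  rewrite (minus_f_none nm) !(mulr0, mul0r).
  by rewrite big1 // => d _; rewrite !(mulr0, mul0r).
rewrite /fall nm /=.
apply: jump_sum_le => //.
- by rewrite !mulr_ge0 ?emp_ge0.
- rewrite mulf_eq0 negb_or => /andP[_ /emp_neq0 cn_gt0].
  by have [d _ dE] := @move_node R _ _ _ N c n m cn_gt0; exists d.
- have := @lyapunov_jump N e c _ (fun x => evec (Some m) x - evec (Some n) x).
  rewrite evec_sum; apply => // [x|x]; first by rewrite mulrC.
  by apply: le_trans (evec_diff _ _ _) _; rewrite ler1n.
Qed.

Lemma internal_move (N : nat) e (c : netstate C A N) n m k :
  (1 < N)%N -> 0 < e ->
  \sum_(d : netstate C A N)
    gamma k * N%:R / (N%:R - 1) * (occ n k)%:R * emp c n *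
      (N%:R * emp c m - (m == n)%:R) *
    ind_eq (emp d) (fun x => emp c x
      + N%:R^-1 * (evec (minus_f n k) x - evec (Some n) x)
      + N%:R^-1 * (evec (plus_f m k) x - evec (Some m) x)
        * (isSome (plus_f m k))%:R) *
    (lyap e (emp d) - lyap e (emp c)) <=
  gamma k * N%:R / (N%:R - 1) * (occ n k)%:R * emp c n *
      (N%:R * emp c m - (m == n)%:R) *
    ((fall e (emp c) n k + rise e (emp c) m k) / N%:R
      + 4 * NX / (N%:R ^+ 2 * e)).
Proof.
move=> N_gt1 e_gt0; have N_gt0 : (0 < N)%N by exact: ltnW.
have [c0|cn_gt0] := posnP (cnt c n).
  have -> : emp c n = 0 :> R by rewrite /emp -/(cnt c n) c0 mul0r.
  by rewrite !(mulr0, mul0r) big1 // => d _; rewrite !(mulr0, mul0r).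
case np : (minus_f n k) => [p|] /=; last first.
  rewrite (minus_f_none np) !(mulr0, mul0r).
  by rewrite big1 // => d _; rewrite !(mulr0, mul0r).
rewrite /fall np /= -cnt_emp //.
have cm_ge : ((m == n) <= cnt c m)%N by case: eqP => [->|].
have N1 : 0 < N%:R - 1 :> R by rewrite subr_gt0 ltr1n.
apply: jump_sum_le => //.
- rewrite mulr_ge0 ?subr_ge0 ?ler_nat // !mulr_ge0 ?emp_ge0 ?ler0n //.
    exact: ltW.
  by rewrite invr_ge0 ltW.
- rewrite mulf_eq0 negb_or => /andP[_].
  (* When m = n a second node in state n is there, because the rate is not 0. *)
  rewrite subr_eq0 eqr_nat => cm_neq.
  have cm_gt : ((m == n) < cnt c m)%N by rewrite ltn_neqAle eq_sym cm_neq.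
  have [d d_cnt dE] := @move_node R _ _ _ N c n p cn_gt0.
  case mq : (plus_f m k) => [q|] /=; last first.
    by exists d => x; rewrite dE mulr0 addr0.
  have dm_gt0 : (0 < cnt d m)%N.
    by have := d_cnt m; rewrite eq_sym; move: cm_gt; case: eqP => _; lia.
  have [d' _ d'E] := @move_node R _ _ _ N d m q dm_gt0.
  by exists d' => x; rewrite d'E dE mulr1.
- pose D x : R := (evec (Some p) x - evec (Some n) x) +
    (evec (plus_f m k) x - evec (Some m) x) * (isSome (plus_f m k))%:R.
  have -> : grad e (emp c) p - grad e (emp c) n + rise e (emp c) m k =
      \sum_x D x * grad e (emp c) x.
    under eq_bigr do rewrite /D mulrDl mulrAC.
    rewrite big_split /= -mulr_suml !evec_sum /rise.
    by case: (plus_f m k) => [q|] /=; rewrite ?mulr1 ?mulr0.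
  apply: lyapunov_jump => // x.
    by rewrite /D; ring.
  rewrite /D; apply: le_trans (ler_normD _ _) _.
  rewrite -[2]/(1 + 1); apply: lerD; first exact: evec_diff.
  rewrite normrM -[leRHS]mulr1; apply: ler_pM => //; first exact: evec_diff.
  by case: (isSome _); rewrite ?normr1 ?normr0.
Qed.

(** Sum of the internal moves of class k: a and b are the increments due to the
    departure and to the arrival, and E is a bound on the remainder. The number
    of possible targets is N - 1 for each customer, which makes the departure
    term exact; the arrival term is exact up to the customers that would go to
    their own node. *)
Lemma internal_move_sum (N : nat) (g E : R) k (y a b : state C A -> R) :
  (1 < N)%N -> \sum_n y n = 1 ->
  \sum_n \sum_m g * N%:R / (N%:R - 1) * (occ n k)%:R * y n *
      (N%:R * y m - (m == n)%:R) * ((a n + b m) / N%:R + E) =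
  g * \sum_n (occ n k)%:R * y n * a n
  + g / (N%:R - 1) *
    \sum_n (N%:R * mean_occ k y - (occ n k)%:R) * y n * b n
  + g * N%:R * mean_occ k y * E.
Proof.
move=> N_gt1 y1; have N_neq0 : N%:R != 0 :> R by rewrite pnatr_eq0 -lt0n ltnW.
have N1_neq0 : N%:R - 1 != 0 :> R by rewrite subr_eq0 pnatr_eq1 neq_ltn N_gt1 orbT.
have delta1 (F : state C A -> R) n : \sum_m (m == n)%:R * F m = F n.
  rewrite (bigD1 n) //= eqxx mul1r big1 ?addr0 // => m /negPf ->.
  by rewrite mul0r.
pose t n m := (occ n k)%:R * y n * (N%:R * y m - (m == n)%:R).
have sum_target n : \sum_m t n m = (occ n k)%:R * y n * (N%:R - 1).
  rewrite -mulr_sumr sumrB -mulr_sumr y1 mulr1; congr (_ * (_ - _)).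
  by rewrite -[RHS](delta1 (fun=> 1) n); apply: eq_bigr => m _; rewrite mulr1.
have sum_source m : \sum_n t n m = (N%:R * mean_occ k y - (occ m k)%:R) * y m.
  rewrite /t; under eq_bigr do rewrite mulrBr.
  rewrite sumrB mulrBl -mulr_suml; congr (_ - _).
    by rewrite -/(mean_occ k y); ring.
  rewrite -(delta1 (fun n => (occ n k)%:R * y n)).
  by apply: eq_bigr => n _; rewrite mulrC eq_sym.
transitivity (\sum_n \sum_m (g / (N%:R - 1) * (a n + N%:R * E) * t n m
    + g / (N%:R - 1) * (b m * t n m))).
  by apply: eq_bigr => n _; apply: eq_bigr => m _; rewrite /t; field;
    rewrite N_neq0 N1_neq0.
under eq_bigr do rewrite big_split /= -mulr_sumr sum_target -mulr_sumr.
rewrite big_split /= -mulr_sumr exchange_big /= addrAC; congr (_ + _).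
  rewrite /mean_occ !mulr_sumr mulr_suml -big_split /=.
  by apply: eq_bigr => n _; field.
congr (_ * _); apply: eq_bigr => n _.
by rewrite -mulr_sumr sum_source mulrC.
Qed.

(** To first order, the drift pairs the net flux through each edge with the
    increment of the gradient. The first correction comes from the choice of the
    target among N - 1 nodes, the second one is the total rate of the jumps, of
    order N, times the remainder of one jump. *)
Lemma drift_le (N : nat) e (c : netstate C A N) : (1 < N)%N -> 0 < e ->
  \sum_(d : netstate C A N) generator lambda gamma mu c d * lyap e (emp d) <=
  \sum_k (\sum_n (edge_flow lambda gamma mu (emp c) n k
        + gamma k / (N%:R - 1) * (mean_occ k (emp c) - (occ n k)%:R) * emp c n)
      * rise e (emp c) n k
    + (lambda k + (gamma k + mu k) * mean_occ k (emp c))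
      * (4 * NX / (N%:R * e))).
Proof.
move=> N_gt1 e_gt0; have N_gt0 : (0 < N)%N by exact: ltnW.
have N_neq0 : N%:R != 0 :> R by rewrite pnatr_eq0 -lt0n.
have N1_neq0 : N%:R - 1 != 0 :> R by rewrite subr_eq0 pnatr_eq1 neq_ltn N_gt1 orbT.
rewrite generator_sum.
set D := fun d : netstate C A N => lyap e (emp d) - lyap e (emp c).
have swap2 (t : netstate C A N -> state C A -> 'I_K -> R) :
    \sum_d (\sum_n \sum_k t d n k) * D d = \sum_k \sum_n \sum_d t d n k * D d.
  under eq_bigr do rewrite mulr_suml.
  rewrite exchange_big [RHS]exchange_big; apply: eq_bigr => n _ /=.
  by under eq_bigr do rewrite mulr_suml; rewrite exchange_big.
have swap3 (t : netstate C A N -> state C A -> state C A -> 'I_K -> R) :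
    \sum_d (\sum_n \sum_m \sum_k t d n m k) * D d =
    \sum_k \sum_n \sum_m \sum_d t d n m k * D d.
  under eq_bigr do rewrite mulr_suml.
  rewrite exchange_big [RHS]exchange_big; apply: eq_bigr => n _ /=.
  under eq_bigr do rewrite mulr_suml.
  rewrite exchange_big [RHS]exchange_big; apply: eq_bigr => m _ /=.
  by under eq_bigr do rewrite mulr_suml; rewrite exchange_big.
under eq_bigr do rewrite /jump_rate -/(D _) !mulrDl.
rewrite !big_split /= !swap2 swap3 -!big_split /=; apply: ler_sum => k _.
set y : state C A -> R := emp c; set E := 4 * NX / (N%:R ^+ 2 * e).
apply: (@le_trans _ _ (\sum_n lambda k * N%:R * y n * (isSome (plus_f n k))%:R
      * (rise e y n k / N%:R + E)
    + \sum_n mu k * (occ n k)%:R * N%:R * y n * (fall e y n k / N%:R + E)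
    + \sum_n \sum_m gamma k * N%:R / (N%:R - 1) * (occ n k)%:R * y n *
      (N%:R * y m - (m == n)%:R)
      * ((fall e y n k + rise e y m k) / N%:R + E))).
  apply: lerD; first apply: lerD.
  - by apply: ler_sum => n _; exact: external_arrival.
  - by apply: ler_sum => n _; exact: external_departure.
  - by apply: ler_sum => n _; apply: ler_sum => m _; exact: internal_move.
have y1 : \sum_n y n = 1 by exact: sum_emp.
have y_ge0 n : 0 <= y n by exact: emp_ge0.
rewrite internal_move_sum //.
have arrivals : \sum_n lambda k * N%:R * y n * (isSome (plus_f n k))%:R
      * (rise e y n k / N%:R + E) <=
    \sum_n lambda k * y n * rise e y n k + lambda k * N%:R * E.
  rewrite -[X in _ + X]mulr1 -[X in _ + _ * X]y1 mulr_sumr -big_split /=.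
  apply: ler_sum => n _; rewrite /rise.
  have E_ge0 : 0 <= E by rewrite divr_ge0 ?mulr_ge0 ?exprn_ge0 // ltW.
  case: (plus_f n k) => [m|] /=.
    by rewrite le_eqVlt; apply/orP; left; apply/eqP; field.
  rewrite !mulr0 mul0r add0r; apply: mulr_ge0 => //.
  by apply: mulr_ge0 => //; rewrite mulr_ge0 // ltW.
have departures : \sum_n mu k * (occ n k)%:R * N%:R * y n
      * (fall e y n k / N%:R + E) =
    mu k * (\sum_n (occ n k)%:R * y n * fall e y n k)
    + mu k * N%:R * mean_occ k y * E.
  rewrite /mean_occ !mulr_sumr mulr_suml -big_split /=.
  by apply: eq_bigr => n _; field.
rewrite departures sum_fall.
have -> : \sum_n (edge_flow lambda gamma mu y n k
      + gamma k / (N%:R - 1) * (mean_occ k y - (occ n k)%:R) * y n)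
      * rise e y n k =
    \sum_n lambda k * y n * rise e y n k
    - (gamma k + mu k) *
      (\sum_n (occ n k).+1%:R * oapp y 0 (plus_f n k) * rise e y n k)
    + gamma k / (N%:R - 1) *
      (\sum_n (N%:R * mean_occ k y - (occ n k)%:R) * y n * rise e y n k).
  rewrite /edge_flow /arrival_rate /departure_rate; move: (mean_occ k y) => I.
  by rewrite !mulr_sumr -sumrB -big_split /=; apply: eq_bigr => n _; field.
have -> : (lambda k + (gamma k + mu k) * mean_occ k y) * (4 * NX / (N%:R * e)) =
    lambda k * N%:R * E + gamma k * N%:R * mean_occ k y * E
    + mu k * N%:R * mean_occ k y * E.
  by rewrite /E; field; rewrite N_neq0 gt_eqF.
lra.
Qed.

(** A single constant that bounds, uniformly in y, twice the rates attached to
    the edges, and their inverses. *)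
Definition rate_bound : R :=
  1 + \sum_k (2 * (lambda k + (gamma k + mu k) * C.+1%:R)
              + (lambda k)^-1 + (gamma k)^-1).

Lemma rate_term_ge0 k :
  0 <= 2 * (lambda k + (gamma k + mu k) * C.+1%:R)
       + (lambda k)^-1 + (gamma k)^-1.
Proof.
have l := ltW (lambda_gt0 k); have g := ltW (gamma_gt0 k).
rewrite !addr_ge0 ?invr_ge0 // mulr_ge0 // addr_ge0 // mulr_ge0 //.
exact: addr_ge0.
Qed.

Lemma rate_bound_ge k :
  2 * (lambda k + (gamma k + mu k) * C.+1%:R)
  + (lambda k)^-1 + (gamma k)^-1 <= rate_bound.
Proof.
rewrite /rate_bound (bigD1 k) //= addrA [1 + _]addrC -addrA lerDl.
by rewrite addr_ge0 // sumr_ge0 // => i _; exact: rate_term_ge0.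
Qed.

Lemma rate_bound_ge1 : 1 <= rate_bound.
Proof. by rewrite lerDl sumr_ge0 // => k _; exact: rate_term_ge0. Qed.

Lemma rate_bound_gt0 : 0 < rate_bound.
Proof. exact: lt_le_trans rate_bound_ge1. Qed.

Local Notation M := rate_bound.

Lemma rate_bounds k (y : state C A -> R) (n : state C A) :
  (forall x, 0 <= y x) -> \sum_x y x = 1 ->
  [/\ 2 * arrival_rate lambda gamma k y <= M, 2 * departure_rate gamma mu n k <= M,
      1 <= M * arrival_rate lambda gamma k y & 1 <= M * departure_rate gamma mu n k].
Proof.
move=> y0 y1; have := rate_bound_ge k; have := mean_occ_le k y0 y1.
have := mean_occ_ge0 k y0; have := arrival_rate_ge lambda gamma_gt0 k y0.
have l := lambda_gt0 k; have g := gamma_gt0 k; have m := mu_ge0 k.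
have li : 0 < (lambda k)^-1 by rewrite invr_gt0.
have gi : 0 < (gamma k)^-1 by rewrite invr_gt0.
have ll : (lambda k)^-1 * lambda k = 1 by rewrite mulVf // gt_eqF.
have gg : (gamma k)^-1 * gamma k = 1 by rewrite mulVf // gt_eqF.
have nC : (occ n k)%:R <= C%:R :> R by rewrite ler_nat occ_le.
have n0 : 0 <= (occ n k)%:R :> R by [].
rewrite /departure_rate /arrival_rate -!natr1.
set I := mean_occ k y; set L := (lambda k)^-1 in li ll *.
set G := (gamma k)^-1 in gi gg *.
move=> aL I0 IC Mk.
have gI : gamma k * I <= gamma k * C%:R by rewrite ler_wpM2l // ltW.
have gI0 : 0 <= gamma k * I by rewrite mulr_ge0 // ltW.
have gn : (gamma k + mu k) * ((occ n k)%:R + 1) <= (gamma k + mu k) * (C%:R + 1).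
  by rewrite ler_wpM2l ?lerD2r // addr_ge0 // ltW.
have mC : 0 <= mu k * (C%:R + 1) by rewrite mulr_ge0 // addr_ge0.
have gC : 0 <= gamma k * (C%:R + 1) by rewrite mulr_ge0 ?addr_ge0 // ltW.
have gs : gamma k <= (gamma k + mu k) * ((occ n k)%:R + 1).
  have : 0 <= gamma k * (occ n k)%:R by rewrite mulr_ge0 // ltW.
  have : 0 <= mu k * ((occ n k)%:R + 1) by rewrite mulr_ge0 // addr_ge0.
  lra.
rewrite mulrDl in Mk.
split; [lra|lra| |].
- have : L * lambda k <= M * (lambda k + gamma k * I).
    by apply: ler_pM => //; rewrite ?ltW //; lra.
  by rewrite ll.
- have : G * gamma k <= M * ((gamma k + mu k) * ((occ n k)%:R + 1)).
    by apply: ler_pM => //; rewrite ?ltW //; lra.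
  by rewrite gg.
Qed.

Lemma rise_bounds e (y : state C A -> R) n k :
  0 < e -> e <= 1 -> (forall x, 0 <= y x) -> \sum_x y x = 1 ->
  edge_flow lambda gamma mu y n k * rise e y n k <=
    - ((isSome (plus_f n k))%:R * edge_flow lambda gamma mu y n k ^+ 2 / M)
    + M * e
  /\ `|rise e y n k| <= 4 * M / e.
Proof.
move=> e_gt0 e_le1 y0 y1; have M_gt0 := rate_bound_gt0.
have y_le1 x : y x <= 1.
  by rewrite -y1 (bigD1 x) //= lerDl sumr_ge0.
rewrite /rise /edge_flow; case nm : (plus_f n k) => [m|] /=; last first.
  rewrite mulr0 mul0r mul0r oppr0 add0r normr0.
  by rewrite !(mulr_ge0, invr_ge0) ?(ltW M_gt0) ?(ltW e_gt0).
have [L2 B2 L1 B1] := rate_bounds k n y0 y1.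
rewrite (gradient_plus lambda_gt0 gamma_gt0 mu_ge0 e_gt0 y0 nm).
have L_gt0 := arrival_rate_gt0 lambda_gt0 gamma_gt0 k y0.
have B_gt0 := departure_rate_gt0 gamma_gt0 mu_ge0 n k.
set L := arrival_rate _ _ _ _ in L_gt0 L2 L1 *.
set B := departure_rate _ _ _ _ in B_gt0 B2 B1 *.
split.
  have yn01 : 0 <= y n <= 1 by rewrite y0 y_le1.
  have ym01 : 0 <= y m <= 1 by rewrite y0 y_le1.
  have := log_dissipation e_gt0 e_le1 yn01 ym01 L_gt0 L2 B_gt0 B2.
  by rewrite mul1r; lra.
have ln_bound a x : 0 < a -> 2 * a <= M -> 1 <= M * a ->
    `|ln (a * (y x + e))| <= 2 * M / e.
  move=> a_gt0 a2 a1.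
  have ye_gt0 : 0 < y x + e by rewrite ltr_wpDl.
  apply: le_trans (ln_abs_le (mulr_gt0 a_gt0 ye_gt0)) _.
  have Me : M <= M / e by rewrite ler_peMr ?(ltW M_gt0) // invf_ge1.
  have u_le : a * (y x + e) <= M.
    apply: le_trans a2; rewrite mulrC ler_wpM2r ?(ltW a_gt0) //.
    by have := y_le1 x; lra.
  have v_le : (a * (y x + e))^-1 <= M / e.
    rewrite invfM; apply: ler_pM; rewrite ?invr_ge0 ?(ltW a_gt0) ?(ltW ye_gt0) //.
      by rewrite -[leLHS]mul1r ler_pdivrMr.
    by rewrite lef_pV2 ?posrE // lerDr.
  lra.
apply: le_trans (ler_normB _ _) _.
have := ln_bound B m B_gt0 B2 B1; have := ln_bound L n L_gt0 L2 L1.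
lra.
Qed.

(** The constant W does not depend on e or N, so that both errors vanish when e
    tends to 0 and N e to infinity. *)
Lemma lyapunov_drift : exists2 W : R, 0 <= W &
  forall (N : nat) e (c : netstate C A N), (1 < N)%N -> 0 < e -> e <= 1 ->
  \sum_(d : netstate C A N) generator lambda gamma mu c d * lyap e (emp d) <=
  - (imbalance lambda gamma mu (emp c) / M) + W * (e + (N%:R * e)^-1).
Proof.
have M_gt0 := rate_bound_gt0.
have M_ge1 := rate_bound_ge1.
have W_ge0 : 0 <= K%:R * (NX * (8 * M ^+ 2 + 4 * M)).
  have M0 := ltW M_gt0; have M2 : 0 <= M ^+ 2 by exact: exprn_ge0.
  by apply: mulr_ge0 => //; apply: mulr_ge0 => //; lra.
exists (K%:R * (NX * (8 * M ^+ 2 + 4 * M))) => // N e c N_gt1 e_gt0 e_le1.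
have N_gt0 : (0 < N)%N by exact: ltnW.
have y0 := @emp_ge0 R _ _ _ _ c; have y1 := @sum_emp R _ _ _ _ N_gt0 c.
apply: le_trans (drift_le c N_gt1 e_gt0) _.
set y : state C A -> R := emp c in y0 y1 *.
have y_le1 x : y x <= 1 by exact: emp_le1.
set h := (N%:R * e)^-1.
have h_ge0 : 0 <= h by rewrite invr_ge0 mulr_ge0 // ltW.
apply: (@le_trans _ _ (\sum_k (\sum_n
    (- ((isSome (plus_f n k))%:R * edge_flow lambda gamma mu y n k ^+ 2 / M)
     + (M * e + 8 * M ^+ 2 * h)) + NX * (4 * M * h)))).
  apply: ler_sum => k _.
  have I0 := mean_occ_ge0 k y0; have IC := mean_occ_le k y0 y1.
  have := rate_bound_ge k.
  have l := lambda_gt0 k; have g := gamma_gt0 k; have m := mu_ge0 k.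
  have li : 0 < (lambda k)^-1 by rewrite invr_gt0.
  have gi : 0 < (gamma k)^-1 by rewrite invr_gt0.
  rewrite -natr1 => Mk.
  set I := mean_occ k y in I0 IC *.
  have gmI : (gamma k + mu k) * I <= (gamma k + mu k) * C%:R.
    by rewrite ler_wpM2l // addr_ge0 // ltW.
  have gmC : 0 <= (gamma k + mu k) * C%:R.
    by rewrite mulr_ge0 // addr_ge0 // ltW.
  have gC : 0 <= gamma k * C%:R by rewrite mulr_ge0 // ltW.
  have mC : 0 <= mu k * C%:R by rewrite mulr_ge0.
  apply: lerD; last first.
    have -> : 4 * NX / (N%:R * e) = NX * (4 * h) by rewrite mulrC /h; ring.
    have -> : NX * (4 * M * h) = M * (NX * (4 * h)) by ring.
    by apply: ler_wpM2r; [rewrite !mulr_ge0|lra].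
  apply: ler_sum => n _.
  have [flow_le rise_le] := rise_bounds n k e_gt0 e_le1 y0 y1.
  rewrite mulrDl addrA; apply: lerD => //.
  apply: le_trans (ler_norm _) _.
  have nC : (occ n k)%:R <= C%:R :> R by rewrite ler_nat occ_le.
  have n0 : 0 <= (occ n k)%:R :> R by [].
  have N2 : 2 <= N%:R :> R by rewrite ler_nat.
  have N1_gt0 : 0 < N%:R - 1 :> R by lra.
  have -> : 8 * M ^+ 2 * h = 2 / N%:R * M * (4 * M / e).
    by rewrite /h invfM; ring.
  rewrite normrM; apply: ler_pM => //.
  rewrite normrM (ger0_norm (y0 n)) -[leRHS]mulr1; apply: ler_pM => //.
  have -> : gamma k / (N%:R - 1) * (I - (occ n k)%:R) =
    (N%:R - 1)^-1 * (gamma k * (I - (occ n k)%:R)) by ring.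
  rewrite normrM; apply: ler_pM => //.
    rewrite ger0_norm ?invr_ge0 ?(ltW N1_gt0) // ler_pdivlMr ?ltr0n //.
    by rewrite mulrC ler_pdivrMr //; lra.
  rewrite normrM (gtr0_norm g).
  have : gamma k * `|I - (occ n k)%:R| <= gamma k * C%:R.
    by rewrite ler_wpM2l ?(ltW g) // ler_norml; apply/andP; split; lra.
  lra.
have -> : \sum_k (\sum_n
    (- ((isSome (plus_f n k))%:R * edge_flow lambda gamma mu y n k ^+ 2 / M)
     + (M * e + 8 * M ^+ 2 * h)) + NX * (4 * M * h)) =
   - (imbalance lambda gamma mu y / M) +
   K%:R * (NX * (M * e + 8 * M ^+ 2 * h + 4 * M * h)).
  rewrite /imbalance exchange_big mulr_suml -sumrN.
  have sumK (x : R) : K%:R * x = \sum_(k < K) x.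
    by rewrite sumr_const card_ord mulr_natl.
  rewrite sumK -big_split /=.
  have sumX (x : R) : \sum_(n : state C A) x = NX * x.
    by rewrite sumr_const mulr_natl.
  apply: eq_bigr => k _.
  by rewrite big_split sumX mulr_suml sumrN -addrA -mulrDr.
rewrite lerD2l -[leRHS]mulrA; apply: ler_wpM2l => //.
rewrite -[leRHS]mulrA; apply: ler_wpM2l => //.
have M2 : 0 <= M ^+ 2 by rewrite exprn_ge0 // ltW.
have : 0 <= M ^+ 2 * e by rewrite mulr_ge0 // ltW.
have : 0 <= M * e by rewrite mulr_ge0 // ltW.
lra.
Qed.

End Drift.

(** * Stationary laws annihilate the generator *)

Section Stationarity.
Context {R : realType} {K C : nat} {A : 'I_K -> nat}.
Variables (lambda gamma mu : 'I_K -> R) (N : nat).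

Local Notation Q := (@generator R K C A lambda gamma mu N).
Local Notation Qpow := (@generator_pow R K C A lambda gamma mu N).
Local Notation P := (@semigroup R K C A lambda gamma mu N).

Definition generator_norm : R := \sum_c \sum_d `|Q c d|.

Local Notation B := generator_norm.

Lemma generator_norm_ge0 : 0 <= B.
Proof. by apply: sumr_ge0 => c _; apply: sumr_ge0. Qed.

Lemma generator_pow_le j c d : `|Qpow j c d| <= B ^+ j.
Proof.
elim: j c d => [|j IHj] c d.
  by rewrite expr0 /generator_pow /=; case: eqP => _; rewrite ?normr1 ?normr0.
rewrite exprS /generator_pow iterS -/(Qpow j).
apply: le_trans (ler_norm_sum _ _ _) _.
have row_le : \sum_e `|Q c e| <= B.
  rewrite /generator_norm [leRHS](bigD1 c) //= lerDl.
  by apply: sumr_ge0 => c' _; apply: sumr_ge0.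
apply: le_trans (ler_wpM2r _ row_le); last exact/exprn_ge0/generator_norm_ge0.
rewrite mulr_suml; apply: ler_sum => e _.
by rewrite normrM ler_wpM2l.
Qed.

Lemma generator_pow1 c d : Qpow 1 c d = Q c d.
Proof.
rewrite /generator_pow /= (bigD1 d) //= eqxx mulr1 big1 ?addr0 // => e.
by move=> /negPf ->; rewrite mulr0.
Qed.

(** First-order expansion of exp(tQ), with the remainder of the exponential
    series of a bound on Q. *)
Lemma semigroup_expansion (t : R) c d : 0 <= t <= 1 ->
  `|P t c d - (c == d)%:R - t * Q c d| <= t ^+ 2 * expR B.
Proof.
move=> /andP[t_ge0 t_le1]; have B_ge0 := generator_norm_ge0.
pose u j := t ^+ j / j`!%:R * Qpow j c d.
have u_le j : `|u j| <= exp_coeff (t * B) j.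
  rewrite /u /exp_coeff /= normrM ger0_norm ?divr_ge0 ?exprn_ge0 //.
  rewrite exprMn mulrAC ler_wpM2r ?invr_ge0 //.
  by rewrite ler_wpM2l ?exprn_ge0 // generator_pow_le.
have u_cvg : cvgn (series u).
  apply: normed_cvg; apply: series_le_cvg u_le _ => //.
    by move=> j; apply: exp_coeff_ge0; rewrite mulr_ge0.
  exact: is_cvg_series_exp_coeff.
have partial m : `|series u m.+2 - (c == d)%:R - t * Q c d| <= t ^+ 2 * expR B.
  have -> : series u m.+2 = (c == d)%:R + t * Q c d + \sum_(2 <= j < m.+2) u j.
    rewrite /series /= big_ltn // big_ltn // addrA; congr (_ + _ + _).
      by rewrite /u expr0 fact0 divr1 mul1r.
    by rewrite /u expr1 divr1 generator_pow1.
  rewrite (_ : _ - _ - _ = \sum_(2 <= j < m.+2) u j); last by ring.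
  apply: le_trans (ler_norm_sum _ _ _) _.
  apply: (@le_trans _ _ (t ^+ 2 * \sum_(2 <= j < m.+2) exp_coeff B j)).
    rewrite mulr_sumr; apply: ler_sum_nat => j /andP[j_ge2 _].
    apply: le_trans (u_le j) _; rewrite /exp_coeff /= exprMn mulrA.
    rewrite ler_wpM2r ?invr_ge0 // ler_wpM2r ?exprn_ge0 //.
    by rewrite ler_wiXn2l.
  apply: ler_wpM2l; first exact: exprn_ge0.
  apply: (@le_trans _ _ (series (exp_coeff B) m.+2)).
    rewrite /series /= (@big_cat_nat _ _ _ 2 0 m.+2) //= lerDr sumr_ge0 // => j _.
    exact: exp_coeff_ge0.
  apply: nondecreasing_cvgn_le; last exact: is_cvg_series_exp_coeff.
  by apply: nondecreasing_series => j _ _; exact: exp_coeff_ge0.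
have far : \forall n \near \oo, (2 <= n)%N by exact: nbhs_infty_ge.
have lower : (c == d)%:R + t * Q c d - t ^+ 2 * expR B <= P t c d.
  apply: limr_ge => //; apply: filterS far => -[|[|m]] // _.
  by have := partial m; rewrite ler_norml; lra.
have upper : P t c d <= (c == d)%:R + t * Q c d + t ^+ 2 * expR B.
  apply: limr_le => //; apply: filterS far => -[|[|m]] // _.
  by have := partial m; rewrite ler_norml; lra.
by rewrite ler_norml; lra.
Qed.

(** Derivative at t = 0 of the invariance under the semigroup. *)
Lemma stationary_generator (p : netstate C A N -> R) :
  (forall t d, 0 <= t -> \sum_c p c * P t c d = p d) ->
  forall d, \sum_c p c * Q c d = 0.
Proof.
move=> inv d; set q := \sum_c _.
pose L := (\sum_c `|p c|) * expR B.
have L_ge0 : 0 <= L by rewrite mulr_ge0 ?expR_ge0 // sumr_ge0.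
have q_le t : 0 < t -> t <= 1 -> `|q| <= t * L.
  move=> t_gt0 t_le1.
  have tq : t * q = - \sum_c p c * (P t c d - (c == d)%:R - t * Q c d).
    have -> : \sum_c p c * (P t c d - (c == d)%:R - t * Q c d) =
        \sum_c p c * P t c d - \sum_c p c * (c == d)%:R - t * q.
      by rewrite mulr_sumr -!sumrB; apply: eq_bigr => c _; ring.
    rewrite inv ?ltW // (bigD1 d) //= eqxx mulr1 big1 ?addr0.
      by ring.
    by move=> c /negPf ->; rewrite mulr0.
  rewrite -(ler_pM2l t_gt0) -[X in X * `|q|](gtr0_norm t_gt0) -normrM tq normrN.
  apply: le_trans (ler_norm_sum _ _ _) _.
  have -> : t * (t * L) = \sum_c `|p c| * (t ^+ 2 * expR B).
    by rewrite -mulr_suml /L; ring.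
  apply: ler_sum => c _; rewrite normrM ler_wpM2l //.
  by apply: semigroup_expansion; rewrite (ltW t_gt0).
apply/eqP; rewrite -normr_eq0; apply/negPn/negP => q_neq0.
have q_gt0 : 0 < `|q| by rewrite lt_def q_neq0 /=.
have s_gt0 : 0 < `|q| + L + 1 by lra.
(* This time is small enough for |q| <= t L to fail. *)
have := q_le (`|q| / (`|q| + L + 1)).
rewrite divr_gt0 // ler_pdivrMr // mul1r mulrAC ler_pdivlMr //.
move=> /(_ isT) h; have {h} : `|q| * (`|q| + L + 1) <= `|q| * L by apply: h; lra.
by rewrite ler_pM2l //; lra.
Qed.

End Stationarity.

(** * Topology and Borel measures on the simplex *)

Section SimplexTopology.
Context {R : realType} {K C : nat} {A : 'I_K -> nat}.

Lemma continuous_sum (T : topologicalType) (I : finType) (F : I -> T -> R) :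
  (forall i, continuous (F i)) -> continuous (fun x => \sum_i F i x).
Proof.
by move=> Fc; apply: continuous_big => // -[a b]; exact: add_continuous.
Qed.

Lemma continuous_mul (T : topologicalType) (f g : T -> R) :
  continuous f -> continuous g -> continuous (fun x => f x * g x).
Proof. by move=> fc gc x; apply: cvgM; [exact: fc|exact: gc]. Qed.

Lemma continuous_add (T : topologicalType) (f g : T -> R) :
  continuous f -> continuous g -> continuous (fun x => f x + g x).
Proof. by move=> fc gc x; apply: cvgD; [exact: fc|exact: gc]. Qed.

Lemma continuous_const (T : topologicalType) (a : R) : continuous (fun _ : T => a).
Proof. by move=> x; exact: cvg_cst. Qed.

Lemma continuous_opp (T : topologicalType) (f : T -> R) :
  continuous f -> continuous (fun x => - f x).
Proof. by move=> fc x; apply: cvgN; exact: fc. Qed.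

Lemma continuous_pcoord n : continuous (fun y : pvec R C A => pcoord y n).
Proof.
move=> y; apply: (@continuous_comp (pvec R C A) {ptws (state C A) -> R} R
  set_val (@proj _ (fun=> R) n)); last exact: proj_continuous.
exact: (@initial_continuous (pvec R C A) {ptws (state C A) -> R} set_val).
Qed.

Lemma continuous_oapp o : continuous (fun y : pvec R C A => oapp (pcoord y) 0 o).
Proof.
by case: o => [n|] /=; [exact: continuous_pcoord|exact: continuous_const].
Qed.

Lemma continuous_mean_occ k : continuous (fun y : pvec R C A => mean_occ k (pcoord y)).
Proof.
apply: continuous_sum => m; apply: continuous_mul; first exact: continuous_const.
exact: continuous_pcoord.
Qed.

Lemma continuous_vector_field (lambda gamma mu : 'I_K -> R) n :
  continuous (fun y : pvec R C A => vector_field lambda gamma mu (pcoord y) n).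
Proof.
apply: continuous_add; apply: continuous_sum => k.
  apply: continuous_mul.
    apply: continuous_add; first exact: continuous_const.
    by apply: continuous_mul; [exact: continuous_const|exact: continuous_mean_occ].
  apply: continuous_add; first exact: continuous_oapp.
  apply: continuous_opp; apply: continuous_mul; first exact: continuous_pcoord.
  exact: continuous_const.
apply: continuous_mul; first exact: continuous_const.
apply: continuous_add; first by
  apply: continuous_mul; [exact: continuous_const|exact: continuous_oapp].
apply: continuous_opp; apply: continuous_mul; first exact: continuous_const.
exact: continuous_pcoord.
Qed.

Lemma continuous_imbalance (lambda gamma mu : 'I_K -> R) :
  continuous (fun y : pvec R C A => imbalance lambda gamma mu (pcoord y)).
Proof.
have flow n k : continuous
    (fun y : pvec R C A => edge_flow lambda gamma mu (pcoord y) n k).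
  apply: continuous_add.
    apply: continuous_mul; last exact: continuous_pcoord.
    apply: continuous_add; first exact: continuous_const.
    by apply: continuous_mul; [exact: continuous_const|exact: continuous_mean_occ].
  apply: continuous_opp; apply: continuous_mul; first exact: continuous_const.
  exact: continuous_oapp.
apply: continuous_sum => n; apply: continuous_sum => k.
by apply: continuous_mul; [exact: continuous_const|apply: continuous_mul].
Qed.

Lemma compact_simplex : compact (@simplex R K C A).
Proof.
have cube : compact [set y : {ptws (state C A) -> R} |
    forall n, `[0, 1]%classic (y n)].
  by apply: (@tychonoff (state C A) (fun=> R) (fun=> `[0, 1]%classic)) => n;
    exact: segment_compact.
apply: (@subclosed_compact _ _ _ _ cube).
  have -> : @simplex R K C A =
      (\bigcap_(n in [set: state C A]) ((proj n) @^-1` [set x : R | 0 <= x])) `&`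
      ((fun y : {ptws (state C A) -> R} => \sum_n y n) @^-1` [set 1 : R]).
    apply/seteqP; split => y /= [h1 h2]; split => // n; [move=> _|]; exact: h1.
  apply: closedI.
    apply: closed_bigI => n _; apply: closed_comp => [y _|].
      exact: proj_continuous.
    exact: closed_ge.
  apply: closed_comp => [y _|]; last exact: closed_eq.
  exact: (@continuous_sum {ptws (state C A) -> R} _ (fun n y => y n)
    (fun n => @proj_continuous _ (fun=> R) n)).
move=> y [y_ge0 y1] n /=; rewrite in_itv /= y_ge0 -y1 (bigD1 n) //= lerDl.
exact: sumr_ge0.
Qed.

(** Compactness passes to the subtype because its topology is the initial one
    for the inclusion. *)
Lemma compact_pvec : compact [set: pvec R C A].
Proof.
move=> F FF _.
have simplexF : (@pcoord R K C A @ F) (@simplex R K C A).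
  apply: (@filterS _ F _ setT) => [y _|]; last exact: filterT.
  exact/set_mem/(valP y).
have [p [p_simplex p_cluster]] :=
  compact_simplex (fmap_proper_filter (@pcoord R K C A) FF) simplexF.
exists (exist _ p (mem_set p_simplex) : pvec R C A); split=> // B D FB.
rewrite nbhsE => -[E [[U U_open <-] Up] ED].
have imageB : (@pcoord R K C A @ F) (@pcoord R K C A @` B).
  by apply: (@filterS _ F _ B) => // y By; exists y.
have nbhsU : nbhs (p : {ptws (state C A) -> R}) U.
  exact: (open_nbhs_nbhs (conj U_open Up)).
have [_ [[y By <-] Uy]] := p_cluster _ _ imageB nbhsU.
by exists y; split=> //; exact: ED.
Qed.

End SimplexTopology.

Section BorelIntegration.
Context {R : realType} {T : ptopologicalType}.

Lemma borel_open (A : set T) : open A -> measurable (A : set (borel T)).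
Proof. exact: sub_gen_smallest. Qed.

Lemma borel_closed (A : set T) : closed A -> measurable (A : set (borel T)).
Proof.
move=> Ac; rewrite -[A]setCK; apply: (@measurableC _ (borel T)).
by apply: borel_open; exact: closed_openC.
Qed.

Lemma continuous_borel (f : T -> R) :
  continuous f -> measurable_fun [set: borel T] (f : borel T -> R).
Proof.
move=> /continuousP fc; apply: (measurability _ (RGenOpens.measurableE R)).
move=> _ [_ [a [b ->] <-]]; rewrite setTI; apply: borel_open.
exact/fc/interval_open.
Qed.

Hypothesis T_compact : compact [set: T].

Lemma continuous_bounded (f : T -> R) : continuous f -> bounded_fun f.
Proof.
move=> fc; have /compact_bounded[M [Mr h]] : compact (f @` [set: T]).
  by apply: continuous_compact T_compact; exact: continuous_subspaceT.
by exists M; split => // x Mx y _; apply: h => //; exists y.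
Qed.

Lemma continuous_integrable (nu : {finite_measure set (borel T) -> \bar R})
  (f : T -> R) : continuous f -> nu.-integrable [set: borel T] (EFin \o f).
Proof.
move=> fc; apply: measurable_bounded_integrable => //.
- by rewrite ltey_eq fin_num_measure.
- exact: continuous_borel.
- exact: continuous_bounded.
Qed.

End BorelIntegration.

(** * Invariant distributions of the network *)

Section InvariantLaw.
Context {R : realType} {K C : nat} {A : 'I_K -> nat}.

Definition atom (N : nat) (c : netstate C A N) : set (borel (pvec R C A)) :=
  [set y : pvec R C A | pcoord y = emp c].

Lemma measurable_atom N (c : netstate C A N) : measurable (atom c).
Proof.
apply: borel_closed.
have -> : atom c =
    \bigcap_(n in [set: state C A])
      ((fun y : pvec R C A => pcoord y n) @^-1` [set emp c n]).
  apply/seteqP; split => y => [yc n _|h]; first exact: (congr1 (@^~ n) yc).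
  by apply/funext => n; exact: h.
apply: closed_bigI => n _; apply: closed_comp => [y _|]; last exact: closed_eq.
exact: continuous_pcoord.
Qed.

Lemma integral_atoms (N : nat) (P : probability (borel (pvec R C A)) R)
    (g : (state C A -> R) -> R) : (0 < N)%N ->
  P [set y : pvec R C A | exists c : netstate C A N, pcoord y = emp c] = 1%E ->
  continuous (fun y : pvec R C A => g (pcoord y)) -> (forall y, 0 <= g y) ->
  \int[P]_y g (pcoord y) =
  \sum_(c : netstate C A N) fine (P (atom c)) * g (emp c).
Proof.
move=> N_gt0 P1 gc g_ge0; set U := [set y | _] in P1.
have mU : measurable (U : set (borel (pvec R C A))).
  have -> : U = \bigcup_(c in [set: netstate C A N]) atom c.
    by apply/seteqP; split => y [c] => [yc|_ yc]; exists c.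
  by apply: countable_bigcupT_measurable => // c; exact: measurable_atom.
pose s (y : borel (pvec R C A)) : \bar R :=
  (\sum_(c : netstate C A N) (g (emp c))%:E * (\1_(atom c) y)%:E)%E.
have term_meas (c : netstate C A N) : measurable_fun [set: borel (pvec R C A)]
    ((fun y => (g (emp c))%:E * (\1_(atom c) y)%:E)%E : _ -> \bar R).
  apply: measurable_funeM; apply/measurable_EFinP.
  by apply: measurable_indic; exact: measurable_atom.
rewrite /Rintegral (@ae_eq_integral _ _ _ _ _ s) //.
- rewrite /s ge0_integral_sum //; last first.
    by move=> c y _; rewrite mule_ge0 // lee_fin.
  have atomE (c : netstate C A N) :
      (\int[P]_y ((g (emp c))%:E * (\1_(atom c) y)%:E)%E)%E =
      (fine (P (atom c)) * g (emp c))%:E.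
    rewrite ge0_integralZl_EFin //.
    - rewrite integral_indic ?setIT //; last exact: measurable_atom.
      rewrite EFinM fineK 1?muleC // fin_num_measure //; exact: measurable_atom.
    - by apply/measurable_EFinP; apply: measurable_indic; exact: measurable_atom.
  by under eq_bigr do rewrite atomE; rewrite sumEFin.
- by apply/measurable_EFinP; exact: continuous_borel.
- exact: emeasurable_sum.
exists (~` U); split; first exact: measurableC.
- by apply: etrans (probability_setC P mU) _; rewrite P1 subee.
move=> y; apply: contra_not => -[c yc] _.
rewrite /s (bigD1 c) //= big1 => [|d dc].
  by rewrite indicE mem_set // mule1 adde0 yc.
rewrite indicE memNset ?mule0 // => yd; case/eqP: dc.
by apply: (@emp_inj R) => // n; rewrite -yc yd.
Qed.

Variables (lambda gamma mu : 'I_K -> R).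
Hypothesis lambda_gt0 : forall k, 0 < lambda k.
Hypothesis gamma_gt0 : forall k, 0 < gamma k.
Hypothesis mu_ge0 : forall k, 0 <= mu k.

Lemma invariant_generator (N : nat) (P : probability (borel (pvec R C A)) R) :
  invariant_distribution lambda gamma mu N P ->
  forall F : netstate C A N -> R,
  \sum_(c : netstate C A N) fine (P (atom c)) *
    (\sum_d generator lambda gamma mu c d * F d) = 0.
Proof.
move=> [_ inv] F.
have atom_fin (c : netstate C A N) : P (atom c) \is a fin_num.
  by rewrite fin_num_measure //; exact: measurable_atom.
have stat0 := @stationary_generator R K C A lambda gamma mu N
  (fun c => fine (P (atom c))).
have stat (d : netstate C A N) : \sum_(c : netstate C A N)
    fine (P (atom c)) * generator lambda gamma mu c d = 0.
  apply: stat0 => t e t_ge0; apply: EFin_inj.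
  rewrite fineK // -[RHS](inv t t_ge0 e) -sumEFin; apply: eq_bigr => c _.
  by rewrite EFinM fineK.
under eq_bigr do rewrite mulr_sumr.
rewrite exchange_big big1 // => d _ /=.
by under eq_bigr do rewrite mulrA; rewrite -mulr_suml stat mul0r.
Qed.

Variable P : nat -> probability (borel (pvec R C A)) R.
Hypothesis P_inv : forall N, (2 <= N)%N ->
  invariant_distribution lambda gamma mu N (P N).

(** The mean drift vanishes under the invariant law, while [lyapunov_drift]
    makes it at most minus the mean imbalance, up to a small error. *)
Lemma mean_imbalance_cvg0 :
  \int[P N]_y imbalance lambda gamma mu (pcoord y) @[N --> \oo] --> (0 : R).
Proof.
have [W W_ge0 drift] :=
  @lyapunov_drift R K C A _ _ _ lambda_gt0 gamma_gt0 mu_ge0.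
set M := rate_bound _ _ _ in drift.
have M_gt0 : 0 < M by exact: rate_bound_gt0.
apply/cvgr0Pnorm_le => eta eta_gt0.
have MW_ge0 : 0 <= M * W by rewrite mulr_ge0 // ltW.
(* Then 2 M W e <= eta, and N >= 1 / e^2 ensures 1 / (N e) <= e. *)
pose e := Num.min 1 (eta / (2 * (M * W + 1))).
have d_gt0 : 0 < 2 * (M * W + 1) by lra.
have e_gt0 : 0 < e by rewrite lt_min ltr01 divr_gt0.
have e_le1 : e <= 1 by rewrite ge_min lexx.
have e_eta : 2 * (M * W) * e <= eta.
  have : e <= eta / (2 * (M * W + 1)) by rewrite ge_min lexx orbT.
  by rewrite ler_pdivlMr //; lra.
have N_ge2 : \forall N \near \oo, (2 <= N)%N by exact: nbhs_infty_ge.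
have N_large : \forall N \near \oo, (e ^+ 2)^-1 <= N%:R by exact: nbhs_infty_ger.
apply: filterS2 N_ge2 N_large => N N2 Ne.
have N_gt0 : (0 < N)%N by exact: ltnW.
have [P1 _] := P_inv N2.
rewrite (integral_atoms N_gt0 P1); [|exact: continuous_imbalance|exact: imbalance_ge0].
have p_ge0 (c : netstate C A N) : 0 <= fine (P N (atom c)) by exact: fine_ge0.
have p1 : \sum_(c : netstate C A N) fine (P N (atom c)) = 1.
  have one : \int[P N]_(y in [set: borel (pvec R C A)]) (1 : R) = 1.
    apply: etrans (Rintegral_cst _ measurableT _) _; rewrite mul1r.
    exact: (congr1 fine (probability_setT (P N))).
  rewrite -[RHS]one (integral_atoms (g := fun=> 1) N_gt0 P1).
  - by apply: eq_bigr => c _; rewrite mulr1.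
  - exact: continuous_const.
  - by move=> y; exact: ler01.
rewrite ger0_norm; last first.
  by apply: sumr_ge0 => c _; rewrite mulr_ge0 // imbalance_ge0.
apply: le_trans e_eta.
have h_le : (N%:R * e)^-1 <= e.
  have NR : 0 < N%:R :> R by rewrite ltr0n.
  have e2 : 0 < e ^+ 2 by rewrite exprn_gt0.
  rewrite -[leLHS]mul1r ler_pdivrMr ?mulr_gt0 //.
  by move: Ne; rewrite -[leLHS]mul1r ler_pdivrMr //; lra.
have := invariant_generator (P_inv N2) (fun d => lyapunov lambda gamma mu e (emp d)).
set S := \sum_c _ => S0.
have : S <= - (M^-1 * \sum_(c : netstate C A N) fine (P N (atom c))
      * imbalance lambda gamma mu (emp c)) + W * (e + e).
  rewrite -[X in _ <= _ + X]mul1r -p1 mulr_suml mulr_sumr -sumrN -big_split /=.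
  apply: ler_sum => c _.
  apply: le_trans (ler_wpM2l (p_ge0 c) (drift N e c N2 e_gt0 e_le1)) _.
  rewrite mulrDr; apply: lerD; first by rewrite mulrN; lra.
  by apply: ler_wpM2l => //; apply: ler_wpM2l => //; rewrite lerD2l.
rewrite S0 => S_le.
have : M^-1 * \sum_(c : netstate C A N) fine (P N (atom c))
    * imbalance lambda gamma mu (emp c) <= W * (e + e) by lra.
by rewrite mulrC ler_pdivrMr //; lra.
Qed.

End InvariantLaw.

(** * Limits of the invariant distributions *)

Section Conclusion.
Context {R : realType} {K C : nat} {A : 'I_K -> nat}.
Variables (lambda gamma mu : 'I_K -> R).

Local Notation X := (borel (pvec R C A)).
Local Notation equilibria :=
  [set y : pvec R C A | equilibrium lambda gamma mu (pcoord y)].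
Local Notation imb := (fun y : pvec R C A => imbalance lambda gamma mu (pcoord y)).

Lemma measurable_equilibria : measurable (equilibria : set X).
Proof.
apply: borel_closed.
have -> : equilibria = \bigcap_(n in [set: state C A])
    ((fun y : pvec R C A => vector_field lambda gamma mu (pcoord y) n)
      @^-1` [set 0]).
  by apply/seteqP; split => y h n; [move=> _|]; exact: h.
apply: closed_bigI => n _; apply: closed_comp => [y _|]; last exact: closed_eq.
exact: continuous_vector_field.
Qed.

Lemma carried_by_equilibria (nu : {finite_measure set X -> \bar R}) :
  \int[nu]_y imb y = 0 -> nu (~` equilibria) = 0%E.
Proof.
move=> int0; have mE := measurable_equilibria.
have imb_int := continuous_integrable compact_pvec nu
  (@continuous_imbalance R K C A lambda gamma mu).
have imb_meas : measurable_fun [set: X] (EFin \o imb).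
  exact: measurable_int imb_int.
have : (\int[nu]_y `|(EFin \o imb) y|)%E = 0%E.
  under eq_integral do rewrite /= ger0_norm ?imbalance_ge0 //.
  by rewrite -[LHS]fineK ?integrable_fin_num // -/(Rintegral _ _ _) int0.
move/(ae_eq_integral_abs nu measurableT imb_meas) => [B [mB B0 subB]].
apply/eqP; rewrite -measure_le0 -B0; apply: le_measure; rewrite ?inE //.
  exact: measurableC.
move=> y ny; apply: subB => /= imb0; apply: ny.
by apply: imbalance_eq0; have [] := imb0 Logic.I.
Qed.

(** Where |f - f yinf| >= eta, which is a compact set without
    equilibria, the imbalance is bounded below by a positive number. *)
Lemma dominated_by_imbalance (yinf : pvec R C A) (f : pvec R C A -> R) (eta : R) :
  (forall y : pvec R C A, equilibrium lambda gamma mu (pcoord y) -> y = yinf) ->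
  continuous f -> 0 < eta ->
  exists2 L : R, 0 <= L & forall y, `|f y - f yinf| <= eta + L * imb y.
Proof.
move=> uniq fc eta_gt0.
have dc : continuous (fun y => `|f y - f yinf|).
  have fc' : continuous (fun y => f y - f yinf).
    by apply: continuous_add => //; exact: continuous_const.
  by move=> y; exact: (cvg_norm (fc' y)).
pose B := [set y | eta <= `|f y - f yinf|].
have B_compact : compact B.
  apply: (@subclosed_compact _ _ _ _ compact_pvec) => //.
  apply: (@closed_comp _ _ (fun y => `|f y - f yinf|) [set x | eta <= x]) => [y _|].
    exact: dc.
  exact: closed_ge.
have [B0|B_empty] := pselect (B !=set0); last first.
  exists 0 => // y; rewrite mul0r addr0 leNgt; apply/negP => /ltW dy.
  by apply: B_empty; exists y.
have [p pB p_min] := compact_EVT_min B0 B_compact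
  (continuous_subspaceT (@continuous_imbalance R K C A lambda gamma mu)).
have [q _ q_max] := compact_EVT_max (ex_intro _ yinf Logic.I) compact_pvec
  (continuous_subspaceT dc).
have imb_gt0 : 0 < imb p.
  rewrite lt_def imbalance_ge0 andbT; apply/negP => /eqP /imbalance_eq0 /uniq pE.
  by move: pB; rewrite inE /B /= pE subrr normr0 leNgt eta_gt0.
exists (`|f q - f yinf| / imb p) => [|y]; first by rewrite divr_ge0 // ltW.
have [near|far] := leP (`|f y - f yinf|) eta.
  apply: le_trans near _; rewrite lerDl mulr_ge0 ?imbalance_ge0 //.
  by rewrite divr_ge0 // ltW.
apply: (@le_trans _ _ (`|f q - f yinf|)); first by apply: q_max; rewrite inE.
rewrite -[leLHS]add0r; apply: lerD; first exact: ltW.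
rewrite -mulrA ler_peMr // mulrC ler_pdivlMr // mul1r.
by apply: p_min; rewrite inE /B /= ltW.
Qed.

End Conclusion.

Theorem proposition5 (R : realType) (K C : nat) (A : 'I_K -> nat)
    (lambda gamma mu : 'I_K -> R)
    (hK : (1 <= K)%N) (hC : (1 <= C)%N) (hA : forall k, (0 < A k)%N)
    (hlambda : forall k, 0 < lambda k) (hgamma : forall k, 0 < gamma k)
    (hmu : forall k, 0 <= mu k)
    (pi_ : nat -> probability (borel (pvec R C A)) R)
    (hpi : forall N : nat, (2 <= N)%N ->
       invariant_distribution lambda gamma mu N (pi_ N)) :
  (forall nu : {finite_measure set (borel (pvec R C A)) -> \bar R},
     limiting_point (fun N => pi_ N) nu ->
     nu setT = 1%E /\
     nu [set y : pvec R C A | equilibrium lambda gamma mu (pcoord y)] = 1%E) /\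
  (forall yinf : pvec R C A,
     equilibrium lambda gamma mu (pcoord yinf) ->
     (forall y : pvec R C A,
        equilibrium lambda gamma mu (pcoord y) -> y = yinf) ->
     weak_cvg (fun N => pi_ N) (dirac (yinf : borel (pvec R C A)))).
Proof.
have imb_cvg := mean_imbalance_cvg0 hlambda hgamma hmu hpi.
have imbc := @continuous_imbalance R K C A lambda gamma mu.
split=> [nu [phi [phi_incr nu_lim]]|yinf _ uniq f fc _].
  have nuT : nu setT = 1%E.
    have one_bounded := continuous_bounded compact_pvec
      (@continuous_const R (pvec R C A) 1).
    have := nu_lim (fun=> 1) (@continuous_const R (pvec R C A) 1) one_bounded.
    rewrite (_ : (fun j => _) = fun=> 1); last first.
      apply/funext => j; apply: etrans (Rintegral_cst _ measurableT _) _.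
      by rewrite mul1r; exact: (congr1 fine (probability_setT (pi_ (phi j)))).
    move=> one_cvg.
    have : 1 = \int[nu]_(y in [set: borel (pvec R C A)]) (1 : R).
      by rewrite -(cvg_lim (@Rhausdorff R) one_cvg) lim_cst //; exact: Rhausdorff.
    rewrite (Rintegral_cst nu measurableT) mul1r => one_eq.
    by rewrite -[LHS]fineK ?fin_num_measure // -one_eq.
  have phi_ge j : (j <= phi j)%N.
    elim: j => // j IHj; exact: leq_ltn_trans IHj (phi_incr _ _ (ltnSn j)).
  have phi_cvg : phi @ \oo --> \oo.
    apply/cvgnyPge => n; apply: filterS (nbhs_infty_ge n) => j nj.
    exact: leq_trans nj (phi_ge j).
  have lim0 := cvg_comp _ _ phi_cvg imb_cvg.
  have := nu_lim _ imbc (continuous_bounded compact_pvec imbc).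
  move=> lim_nu.
  have int0 : \int[nu]_y imbalance lambda gamma mu (pcoord y) = 0.
    exact: (cvg_unique (@Rhausdorff R) lim_nu lim0).
  have compl0 := carried_by_equilibria int0.
  split=> //; rewrite -nuT -[LHS]adde0 -compl0 -measureU ?setUv //.
  - exact: measurable_equilibria.
  - by apply: measurableC; exact: measurable_equilibria.
  - by rewrite setICr.
have -> : \int[dirac (yinf : borel (pvec R C A))]_x f x = f yinf.
  rewrite /Rintegral integral_dirac //; last first.
    by apply/measurable_EFinP; exact: continuous_borel.
  by rewrite diracT mul1e.
apply/cvgrPdist_le => eta eta_gt0.
have eta2_gt0 : 0 < eta / 2 by rewrite divr_gt0.
have [L L_ge0 f_le] := dominated_by_imbalance uniq fc eta2_gt0.
have L1 : 0 < L + 1 by rewrite ltr_wpDl.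
have small_gt0 : 0 < eta / 2 / (L + 1) by rewrite divr_gt0.
have small : \forall N \near \oo,
    `|\int[pi_ N]_y imbalance lambda gamma mu (pcoord y)| <= eta / 2 / (L + 1).
  exact: (cvgr0Pnorm_le _).1 imb_cvg _ small_gt0.
apply: filterS small => N I_le.
have fint (g : pvec R C A -> R) : continuous g -> (pi_ N).-integrable setT (EFin \o g).
  exact: (continuous_integrable compact_pvec (pi_ N)).
have cst_c (a : R) : continuous (fun _ : pvec R C A => a).
  exact: continuous_const.
have mean_cst (a : R) : \int[pi_ N]_(y in [set: borel (pvec R C A)]) a = a.
  apply: etrans (Rintegral_cst _ measurableT _) _.
  by rewrite [X in _ * X](congr1 fine (probability_setT (pi_ N))) mulr1.
have dc : continuous (fun y => f y - f yinf).
  by apply: continuous_add => //; exact: cst_c.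
have Lc : continuous (fun y : pvec R C A => L * imbalance lambda gamma mu (pcoord y)).
  by apply: continuous_mul => //; exact: cst_c.
rewrite distrC -[f yinf in leLHS]mean_cst -RintegralB //; [|exact: fint..].
apply: le_trans (le_normr_Rintegral measurableT (fint _ dc)) _.
apply: (@le_trans _ _ (\int[pi_ N]_y
    (eta / 2 + L * imbalance lambda gamma mu (pcoord y)))).
  apply: le_Rintegral => //; apply: fint.
    by move=> y; exact: (cvg_norm (dc y)).
  by apply: continuous_add => //; exact: cst_c.
rewrite RintegralD //; [|exact: fint..].
rewrite mean_cst RintegralZl //; last exact: fint.
set I := Rintegral _ _ _ in I_le *.
have I_le' : I <= eta / 2 / (L + 1) by exact: le_trans (ler_norm _) I_le.
have LI : L * I <= L * (eta / 2 / (L + 1)) by exact: ler_wpM2l.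
have : L * (eta / 2 / (L + 1)) <= eta / 2.
  by rewrite mulrA ler_pdivrMr //; nra.
lra.
Qed.
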